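(* Let $(R,\mathfrak{m})$ be a commutative Noetherian local ring. Then the following are equivalent: (i) $R$ is Gorenstein; (ii) every non-zero proper unmixed ideal $\mathfrak{a}$ of $R$ is linked by $(x_1,\dots,x_t)$ for every $R$-regular sequence $x_1,\dots,x_t$ of length $t=\operatorname{grade}\mathfrak{a}$ with $(x_1,\dots,x_t)\subsetneq\mathfrak{a}$.
   Context: Regular sequences may be empty ($t=0$, generating the zero ideal). An ideal $\mathfrak{a}$ is linked by an ideal $I$ generated by an $R$-regular sequence if $\mathfrak{a}$ is a non-zero proper ideal containing $I$ and there is a non-zero proper ideal $\mathfrak{b}\supseteq I$ with $\mathfrak{b}=I:_R\mathfrak{a}$ and $\mathfrak{a}=I:_R\mathfrak{b}$. A proper ideal $\mathfrak{a}$ of the local ring $R$ is unmixed if $\dim R/\mathfrak{p}=\dim R/\mathfrak{a}$ for all $\mathfrak{p}\in\operatorname{Ass}(R/\mathfrak{a})$. The grade of $\mathfrak{a}$ is the common length of all maximal $R$-regular sequences in $\mathfrak{a}$. *)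

(* Defs.v *)
From HB Require Import structures.
From mathcomp Require Import all_boot all_order all_algebra.
From mathcomp Require Import boolp classical_sets.
Set Implicit Arguments.
Unset Strict Implicit.
Unset Printing Implicit Defensive.
Import GRing.Theory.
Local Open Scope ring_scope.
Local Open Scope classical_set_scope.

(* MathComp's [idealr_closed] builds in properness and decidability, so ideals *)
(* are sets here; [ideal] allows the unit ideal.                               *)
Section Ideals.
Variable R : comNzRingType.
Implicit Types (I J a b p : set R) (xs : seq R).

Definition ideal I : Prop :=
  [/\ I 0, (forall x y, I x -> I y -> I (x + y))
    & (forall r x, I x -> I (r * x))].

Definition ideal_proper I : Prop := ideal I /\ I <> setT.

Definition nonzero_proper I : Prop := ideal_proper I /\ I <> [set 0].

Definition prime_ideal p : Prop :=
  ideal_proper p /\ forall x y, p (x * y) -> p x \/ p y.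

Definition maximal_ideal m : Prop :=
  ideal_proper m /\ forall I, ideal_proper I -> m `<=` I -> I = m.

Definition local_ring m : Prop :=
  maximal_ideal m /\ forall I, maximal_ideal I -> I = m.

Definition ideal_gen xs : set R :=
  [set y | exists c : 'I_(size xs) -> R, y = \sum_(i < size xs) c i * xs`_i].

Definition noetherian : Prop :=
  forall I, ideal I -> exists xs, I = ideal_gen xs.

Definition colon I J : set R := [set r | forall x, J x -> I (r * x)].

Definition regular_seq xs : Prop :=
  ideal_gen xs <> setT /\
  forall i, (i < size xs)%N ->
    forall r, ideal_gen (take i xs) (xs`_i * r) -> ideal_gen (take i xs) r.

Definition maximal_regular_seq_in a xs : Prop :=
  [/\ regular_seq xs, [set` xs] `<=` a
    & forall y, a y -> ~ regular_seq (rcons xs y)].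

Definition is_grade a (t : nat) : Prop :=
  (exists xs, maximal_regular_seq_in a xs) /\
  forall xs, maximal_regular_seq_in a xs -> size xs = t.

(* Strict chains p_0 < ... < p_n of primes containing I, i.e. of primes of R/I *)
Definition prime_chain I (n : nat) : Prop :=
  exists p : nat -> set R,
    (forall i, (i <= n)%N -> prime_ideal (p i) /\ I `<=` p i) /\
    (forall i, (i < n)%N -> p i `<` p i.+1).

(* dim R/I for a proper ideal I, where [None] stands for infinite dimension    *)
Definition quotient_dim I : option nat :=
  xget None [set o | exists n,
    [/\ o = Some n, prime_chain I n
      & forall k, prime_chain I k -> (k <= n)%N]].

(* Ass(R/I): the primes that are the annihilator of the class of some x in R/I *)
Definition quotient_ass I : set (set R) :=
  [set p | prime_ideal p /\ exists x, p = [set r | I (r * x)]].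

Definition unmixed a : Prop :=
  ideal_proper a /\ forall p, quotient_ass a p -> quotient_dim p = quotient_dim a.

Definition linked_by a I : Prop :=
  (exists2 xs, regular_seq xs & I = ideal_gen xs) /\
  [/\ nonzero_proper a, I `<=` a
    & exists b,
        [/\ nonzero_proper b, I `<=` b, b = colon I a & a = colon I b]].

End Ideals.

Section Gorenstein.
Variable R : comNzRingType.

Definition injective_module (E : lmodType R) : Prop :=
  forall (A B : lmodType R) (f : {linear A -> B}) (g : {linear A -> E}),
    injective f -> exists h : {linear B -> E}, forall x, h (f x) = g x.

(* There is an exact sequence 0 -> M -> E_0 -> ... -> E_n -> 0 with all E_i    *)
(* injective, encoded as an infinite resolution vanishing beyond degree n.     *)
Definition inj_dim_le (M : lmodType R) (n : nat) : Prop :=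
  exists (E : nat -> lmodType R) (eps : {linear M -> E 0%N})
         (d : forall i, {linear E i -> E i.+1}),
    [/\ (forall i, injective_module (E i)),
        injective eps,
        range eps = [set x | d 0%N x = 0],
        (forall i, range (d i) = [set x | d i.+1 x = 0])
      & (forall i, (n < i)%N -> forall x : E i, x = 0)].

Definition gorenstein : Prop := exists n, inj_dim_le R^o n.

End Gorenstein.

Arguments noetherian : clear implicits.
Arguments gorenstein : clear implicits.

(* Main.v *)
(* Write Ext^j(R/J, R) as the cohomology of the J-torsion of an injective       *)
(* resolution of R.                                                             *)
(*                                                                              *)
(* If R is Gorenstein, then Ext^j(k, R) <> 0 only for j = depth R (Bass). By    *)
(* Nakayama, if the localization of Ext^i(R/p, R) at p is nonzero, so is that   *)
(* of Ext^j(R/q, R) at q for some j > i whenever p < q, with j = i + 1 for a    *)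
(* suitable q; hence dim R/p = depth R - i. With I = (x_1, ..., x_t),           *)
(* Ext^t(R/J, R) = (I : J)/I for J >= I, so every p in Ass(R/I) has dimension   *)
(* depth R - t. If a >= I has grade t and is unmixed, the primes in Ass(R/a)    *)
(* have that dimension too, so they are minimal over I and in Ass(R/I). If y    *)
(* were in I : (I : a) with p = (a : y) in Ass(R/a), then multiplication by y   *)
(* would induce the zero map from (I : a)/I = Ext^t(R/a, R) to                  *)
(* (I : p)/I = Ext^t(R/p, R), whereas it is onto after localization at p since  *)
(* Ext^{t+1}(R/(a + y), R) vanishes there.                                      *)
(*                                                                              *)
(* Conversely, let I be generated by a maximal regular sequence in m, of        *)
(* length T. The ideals I : J with J m-primary over I have a maximal member;    *)
(* linkage of J and of mJ + I, with Nakayama, shows that I is m-primary. Then   *)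
(* every ideal over I equals its double colon, so (I : m)/I is simple and       *)
(* Ext^T(R/K, R) -> Ext^T(k, R) is onto for each embedding of k in R/K, K >= I. *)
(* Climbing from I to m by steps with quotient k gives Ext^j(k, R) = 0 for      *)
(* j > T, and Noetherian induction gives Ext^j(R/J, R) = 0 for all J.           *)

Require Import Defs.
From HB Require Import structures.
From mathcomp Require Import all_boot all_order all_algebra.
From mathcomp Require Import boolp classical_sets functions.
From mathcomp Require Import lra ring zify.
Set Implicit Arguments.
Unset Strict Implicit.
Unset Printing Implicit Defensive.
Import Order.TTheory GRing.Theory Num.Theory.
Local Open Scope ring_scope.
Local Open Scope classical_set_scope.

(** Both directions are read off from Ext^j(R/J, R), handled elementwise in an injective resolution
    of R: [killed J] plays the role of Hom(R/J, -), and [ext_vanish q j J] says that Ext^j(R/J, R)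
    vanishes after localization at q. For I generated by a regular sequence of length t and J over
    I, [regular_ext_eq], [regular_ext_cocycle] and [regular_ext_inj] identify Ext^t(R/J, R) with (I
    : J)/I, so statements about colon ideals become statements about Ext.

    If R is Gorenstein, Ext^j(k, R) for the residue field k lives only in degree T = depth R
    ([finite_resolution_ext]). Then [chain_bound] and [chain_exists] translate the non-vanishing of
    Ext^i(R/p, R) at p into dim R/p = T - i, and with this control of dimensions [double_colon]
    shows a = I : (I : a).

    Conversely, linkage of m-primary ideals makes a maximal regular sequence generate an m-primary
    ideal I ([I_m_primary]) and makes (I : m)/I simple ([socle_onto]). Hence Ext^j(k, R) = 0 for j >
    T ([ext_vanish_above_depth]), [ext_vanish_above] spreads this to all R/J, and
    [injective_dimension_le] truncates the resolution at T. *)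

(** * Submodules, partial linear maps and Baer's criterion *)

Definition submodule (R : comNzRingType) (V : lmodType R) (S : set V) : Prop :=
  [/\ S 0, (forall x y, S x -> S y -> S (x + y))
    & (forall r x, S x -> S (r *: x))].

Section SubmoduleTheory.
Variables (R : comNzRingType) (V : lmodType R) (S : set V).
Hypothesis S_sub : submodule S.

Lemma submoduleN x : S x -> S (- x).
Proof. by case: S_sub => _ _ h Sx; rewrite -scaleN1r; apply: h. Qed.

Lemma submoduleB x y : S x -> S y -> S (x - y).
Proof. by case: S_sub => _ h _ Sx Sy; apply: h => //; apply: submoduleN. Qed.

Lemma submodule_sum n (f : 'I_n -> V) :
  (forall i, S (f i)) -> S (\sum_i f i).
Proof. by case: S_sub => h0 hD _ h; apply: big_ind. Qed.

(** The proof of closure is an argument, so that the closure instance can be attached to the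
    predicate. *)
Definition submodule_pred of submodule S : {pred V} := fun x => `[< S x >].

Lemma submodule_predP : GRing.submod_closed (submodule_pred S_sub).
Proof.
case: (S_sub) => h0 hD hZ; split; first by apply/asboolP.
by move=> a x y /asboolP Sx /asboolP Sy; apply/asboolP/hD => //; apply: hZ.
Qed.

HB.instance Definition _ := GRing.isSubmodClosed.Build R V
  (submodule_pred S_sub) submodule_predP.

Record submodule_type := SubmoduleType
  { submodule_val : V; _ : submodule_val \in submodule_pred S_sub }.
HB.instance Definition _ := [isSub for submodule_val].
HB.instance Definition _ := [Choice of submodule_type by <:].
HB.instance Definition _ := [SubChoice_isSubLmodule of submodule_type by <:].

Lemma submodule_valP (x : submodule_type) : S (val x).
Proof. by case: x => x /= /asboolP. Qed.

Definition to_submodule x (Sx : S x) : submodule_type :=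
  SubmoduleType (asboolT Sx : x \in submodule_pred S_sub).

End SubmoduleTheory.

Lemma range_submodule (R : comNzRingType) (V W : lmodType R)
  (f : {linear V -> W}) : submodule (range f).
Proof.
split; first by exists 0; rewrite ?raddf0.
  by move=> _ _ [x _ <-] [y _ <-]; exists (x + y); rewrite ?raddfD.
by move=> r _ [x _ <-]; exists (r *: x); rewrite ?linearZ.
Qed.

(* A partial linear map from [B] to [E], given by its graph [G] *)
Definition partial_linear (R : comNzRingType) (B E : lmodType R)
    (G : B -> E -> Prop) : Prop :=
  submodule [set p : B * E | G p.1 p.2] /\ forall e, G 0 e -> e = 0.

Section PartialLinear.
Variables (R : comNzRingType) (B E : lmodType R) (G : B -> E -> Prop).
Hypothesis G_lin : partial_linear G.

Lemma partial_linear_inj b e e' : G b e -> G b e' -> e = e'.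
Proof.
case: G_lin => Gs G0 Ge Ge'; apply/eqP; rewrite -subr_eq0; apply/eqP/G0.
by have := @submoduleB _ _ _ Gs (b, e) (b, e') Ge Ge'; rewrite /= subrr.
Qed.

(** The graph is itself a module; its first projection is injective, and the second projection is
    extended along it. *)
Lemma injective_partial : injective_module E ->
  exists h : {linear B -> E}, forall b e, G b e -> h b = e.
Proof.
case: (G_lin) => Gs G0 Einj.
pose A := submodule_type Gs.
pose f : {linear A -> B} := (@fst B E) \o (val : {linear A -> _}).
pose g : {linear A -> E} := (@snd B E) \o (val : {linear A -> _}).
have finj : injective f.
  move=> x y; rewrite /f /= => fxy; apply: val_inj.
  move: (submodule_valP x) (submodule_valP y) fxy => /=.
  case: (val x) => [a1 a2]; case: (val y) => [b1 b2] /= h1 h2 e.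
  by rewrite e in h1 *; rewrite (partial_linear_inj h1 h2).
have [h hE] := Einj A B f g finj.
exists h => b e Gbe.
exact: (hE (@to_submodule _ _ _ Gs (b, e) Gbe)).
Qed.

End PartialLinear.

(** Baer's condition relative to a submodule S: a map from an ideal of R into S, given by its graph,
    is multiplication by an element of S. The relative form serves for the kernel in
    [injective_dimension_le]. *)
Definition baer (R : comNzRingType) (E : lmodType R) (S : set E) : Prop :=
  forall G : R -> E -> Prop, partial_linear (G : R^o -> E -> Prop) ->
  (forall r e, G r e -> S e) ->
  exists2 e, S e & forall r c, G r c -> r *: e = c.

Section BaerCriterion.
Variables (R : comNzRingType) (E : lmodType R) (S : set E).
Hypotheses (S_sub : submodule S) (S_baer : baer S).

Section Extension.
Variables (B : lmodType R) (G : B -> E -> Prop).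
Hypotheses (G_lin : partial_linear G) (GS : forall b e, G b e -> S e).

Lemma maximal_partial : exists H : B -> E -> Prop,
  [/\ partial_linear H, (forall b e, H b e -> S e),
      (forall b e, G b e -> H b e)
    & forall K : B -> E -> Prop, partial_linear K ->
      (forall b e, K b e -> S e) -> (forall b e, H b e -> K b e) ->
      forall b e, K b e -> H b e].
Proof.
pose good (A : set (B * E)) := [/\ partial_linear (fun b e => A (b, e)),
  (forall b e, A (b, e) -> S e) & forall b e, G b e -> A (b, e)].
have [F Fg Ftot|A [hA Amax]] := @Zorn_bigcup _ [set A | A = set0 \/ good A].
  have [[A0 FA0 gA0]|nF] := pselect (exists2 A, F A & good A); last first.
    left; rewrite -subset0 => p [A FA Ap].
    have [A0|gA] := Fg A FA; first by rewrite A0 in Ap.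
    by apply: nF; exists A.
  right; have goodF X p : F X -> X p -> good X.
    by move=> FX Xp; have [X0|//] := Fg X FX; rewrite X0 in Xp.
  split; last by move=> b e Gbe; exists A0 => //; case: gA0 => _ _; apply.
    split; [split|] => /=.
    - by exists A0 => //; case: gA0 => -[[]].
    - move=> [x1 x2] [y1 y2] /= [X FX Xx] [Y FY Yy].
      have [XY|YX] := Ftot X Y FX FY.
        exists Y => //; have [[[_ h _] _] _ _] := goodF _ _ FY Yy.
        exact: (h (x1, x2) (y1, y2) (XY _ Xx) Yy).
      exists X => //; have [[[_ h _] _] _ _] := goodF _ _ FX Xx.
      exact: (h (x1, x2) (y1, y2) Xx (YX _ Yy)).
    - move=> r [x1 x2] /= [X FX Xx]; exists X => //.
      by have [[[_ _ h] _] _ _] := goodF _ _ FX Xx; exact: (h r (x1, x2)).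
    - by move=> e [X FX Xe]; have [[_ h] _ _] := goodF _ _ FX Xe; exact: h.
  by move=> b e [X FX Xe]; have [_ h _] := goodF _ _ FX Xe; exact: (h b).
have {hA} gA : good A.
  case: hA => // A0; exfalso.
  apply: (Amax [set p | G p.1 p.2]); last by right; split.
  rewrite A0; split=> // h; have := h (0, 0); apply.
  by case: G_lin => -[].
case: (gA) => A1 A2 A3; exists (fun b e => A (b, e)); split=> // K K1 K2 K3 b e Kbe.
apply: contrapT => nA; apply: (Amax [set p | K p.1 p.2]).
  by split=> [[x y] /= /K3 //|h]; exact/nA/(h (b, e)).
by right; split=> // x y /A3 /K3.
Qed.

(** A maximal extension H is total: for any b, the map r -> H (r b) on the ideal of those r with r b
    in the domain is multiplication by some e0, and sending b to e0 extends H. *)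
Lemma baer_partial : exists h : {linear B -> E},
  (forall b, S (h b)) /\ forall b e, G b e -> h b = e.
Proof.
case: S_sub => S0 SD SZ.
have [H [H1 H2 H3 H4]] := maximal_partial.
have H1' := H1; case: H1' => -[/= K0 KD KZ] Kf.
have KD' x1 x2 y1 y2 : H x1 x2 -> H y1 y2 -> H (x1 + y1) (x2 + y2).
  exact: (KD (x1, x2) (y1, y2)).
have KZ' r x1 x2 : H x1 x2 -> H (r *: x1) (r *: x2) by exact: (KZ r (x1, x2)).
have Htot b : exists e, H b e.
  have [||e0 Se0 he0] := S_baer (G := fun r e => H (r *: b) e).
  - split; [split|] => /=.
    + by rewrite scale0r.
    + by move=> [x1 x2] [y1 y2] /= hx hy; rewrite scalerDl; apply: KD'.
    + by move=> r [x1 x2] /= hx; rewrite -scalerA; apply: KZ'.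
    + by move=> e; rewrite scale0r; apply: Kf.
  - by move=> r e; apply: H2.
  pose K (x : B) (e : E) :=
    exists r y c, [/\ H y c, x = y + r *: b & e = c + r *: e0].
  exists e0; apply: (H4 K).
  - split; [split|] => /=.
    + by exists 0, 0, 0; rewrite !scale0r !addr0.
    + move=> _ _ [r [y [c [h1 -> ->]]]] [r' [y' [c' [h1' -> ->]]]].
      exists (r + r'), (y + y'), (c + c'); split; first exact: KD'.
        by rewrite scalerDl addrACA.
      by rewrite scalerDl addrACA.
    + move=> s _ [r [y [c [h1 -> ->]]]]; exists (s * r), (s *: y), (s *: c).
      by split; [exact: KZ'|rewrite scalerDr scalerA|rewrite scalerDr scalerA].
    + move=> e [r [y [c [h1 /esym/eqP h2 ->]]]].
      rewrite addr_eq0 in h2; move/eqP: h2 => h2; subst y.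
      by rewrite (he0 r (- c)) ?subrr // -[r *: b]opprK -!(scaleN1r (- _));
        rewrite -(scaleN1r c); apply: KZ'.
  - move=> x e [r [y [c [h1 _ ->]]]].
    by apply: SD; [exact: H2 h1|exact: SZ].
  - by move=> x e h; exists 0, x, e; rewrite !scale0r !addr0.
  by exists 1, 0, 0; rewrite !scale1r !add0r.
have [h hH] := choice Htot.
have h_lin : linear h.
  move=> a x y; apply: (partial_linear_inj H1 (hH _)).
  by apply: KD' => //; apply: KZ'.
pose hm := GRing.isLinear.Build R B E _ h h_lin.
pose hl : {linear B -> E} := HB.pack h hm.
exists hl; split=> [b|b e Gbe]; first exact: H2 (hH b).
exact: (partial_linear_inj H1 (hH b) (H3 _ _ Gbe)).
Qed.

End Extension.

Lemma baer_injective : injective_module (submodule_type S_sub).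
Proof.
move=> A B f g finj.
pose G (b : B) (e : E) := exists a, b = f a /\ e = val (g a).
have [||h [hS hG]] := @baer_partial B G.
- split; [split|] => /=.
  + by exists 0; rewrite !raddf0.
  + move=> _ _ [a [-> ->]] [a' [-> ->]]; exists (a + a').
    by rewrite !raddfD.
  + by move=> r _ [a [-> ->]]; exists (r *: a); rewrite !linearZ.
  + move=> e [a []]; rewrite -(raddf0 f) => /finj <- ->.
    by rewrite !raddf0.
- by move=> b e [a [_ ->]]; exact: submodule_valP.
pose k b := to_submodule S_sub (hS b).
have k_lin : linear k by move=> r x y; apply: val_inj; rewrite /= linearP.
pose km := GRing.isLinear.Build R B _ _ k k_lin.
pose kl : {linear B -> submodule_type S_sub} := HB.pack k km.
by exists kl => a; apply: val_inj; apply: hG; exists a.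
Qed.

End BaerCriterion.

Lemma submoduleT (R : comNzRingType) (V : lmodType R) : submodule [set: V].
Proof. by []. Qed.

Lemma baerT_injective (R : comNzRingType) (E : lmodType R) :
  baer [set: E] -> injective_module E.
Proof.
move=> Eb A B f g finj.
pose G (b : B) (e : E) := exists a, b = f a /\ e = g a.
have [||h [_ hG]] := @baer_partial _ _ _ (submoduleT E) Eb B G.
- split; [split|] => /=.
  + by exists 0; rewrite !raddf0.
  + move=> _ _ [a [-> ->]] [a' [-> ->]]; exists (a + a').
    by rewrite !raddfD.
  + by move=> r _ [a [-> ->]]; exists (r *: a); rewrite !linearZ.
  + by move=> e [a []]; rewrite -(raddf0 f) => /finj <- ->; rewrite raddf0.
- by [].
by exists h => a; apply: hG; exists a.
Qed.

(** * The group Q/Z and its characters *)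

(* [Q/Z], realised as the rationals of [0, 1) with addition modulo 1 *)
Record circle := Circle { circle_val : rat; _ : 0 <= circle_val < 1 }.
HB.instance Definition _ := [isSub for circle_val].
HB.instance Definition _ := [Choice of circle by <:].

Lemma circleP (x : circle) : 0 <= circle_val x < 1.
Proof. by case: x. Qed.

Lemma circle_add_subproof (x y : circle) :
  0 <= (if circle_val x + circle_val y < 1 then circle_val x + circle_val y
        else circle_val x + circle_val y - 1) < 1.
Proof.
by move: (circleP x) (circleP y) => /andP[? ?] /andP[? ?]; case: ltP => ?; lra.
Qed.

Lemma circle_opp_subproof (x : circle) :
  0 <= (if circle_val x == 0 then 0 else 1 - circle_val x) < 1.
Proof.
move: (circleP x) => /andP[? ?]; case: ifP => // /negbT x0.
have : 0 < circle_val x by rewrite lt_neqAle eq_sym x0.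
by move=> ?; lra.
Qed.

Definition circle0 : circle := @Circle 0 isT.
Definition circle_add x y := Circle (circle_add_subproof x y).
Definition circle_opp x := Circle (circle_opp_subproof x).

Lemma circle_addA : associative circle_add.
Proof.
move=> x y z; apply: val_inj => /=.
move: (circleP x) (circleP y) (circleP z) => /andP[? ?] /andP[? ?] /andP[? ?].
case: (ltP (circle_val y + circle_val z) 1) => ?;
case: (ltP (circle_val x + circle_val y) 1) => ?;
by do 2!case: ltP => ?; lra.
Qed.

Lemma circle_addC : commutative circle_add.
Proof. by move=> x y; apply: val_inj => /=; rewrite [circle_val y + _]addrC. Qed.

Lemma circle_add0 : left_id circle0 circle_add.
Proof.
by move=> x; apply: val_inj => /=; rewrite add0r; case: (circleP x) => /andP[_ ->].
Qed.

Lemma circle_addN : left_inverse circle0 circle_opp circle_add.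
Proof.
move=> x; apply: val_inj => /=; case: eqP => [->|_]; first by rewrite addr0.
by rewrite subrK ltxx subrr.
Qed.

HB.instance Definition _ := GRing.isZmodule.Build circle
  circle_addA circle_addC circle_add0 circle_addN.

Lemma circle_valD (x y : circle) : circle_val x + circle_val y < 1 ->
  circle_val (x + y) = circle_val x + circle_val y.
Proof. by move=> h; rewrite /GRing.add /= h. Qed.

Lemma circle_valMn (x : circle) n : circle_val x *+ n < 1 ->
  circle_val (x *+ n) = circle_val x *+ n.
Proof.
elim: n => [//|n IHn]; rewrite !mulrS => h.
have hn : circle_val (x *+ n) = circle_val x *+ n.
  by apply: IHn; move: (circleP x) => /andP[? ?]; lra.
by rewrite circle_valD hn.
Qed.

Lemma circle_divisible (c : circle) n : exists x, x *+ n.+1 = c.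
Proof.
have n0 : (0 : rat) < n.+1%:R by rewrite ltr0Sn.
have /andP[c0 c1] := circleP c.
have xP : 0 <= circle_val c / n.+1%:R < 1.
  rewrite divr_ge0 ?ler0n //= ltr_pdivrMr // mul1r (lt_le_trans c1) //.
  by rewrite ler1n.
exists (Circle xP); apply: val_inj; rewrite /= circle_valMn /=.
  by rewrite -(mulr_natr (_ / _)) divfK // gt_eqF.
by rewrite -(mulr_natr (_ / _)) divfK // gt_eqF.
Qed.

Lemma circle_torsion n : exists2 x : circle, x != 0 & x *+ n.+2 = 0.
Proof.
have n0 : (0 : rat) < n.+2%:R by rewrite ltr0Sn.
have xP : 0 <= (n.+2%:R^-1 : rat) < 1.
  by rewrite invr_ge0 ler0n /= invf_lt1 // ltr1n.
exists (Circle xP).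
  by apply/negP => /eqP/(congr1 val)/= /eqP; rewrite invr_eq0 gt_eqF.
have e : n.+2%:R^-1 + n.+2%:R^-1 *+ n.+1 = 1 :> rat.
  by rewrite -mulrS -(mulr_natr _^-1) mulVf // gt_eqF.
have h : n.+2%:R^-1 *+ n.+1 < (1 : rat).
  by rewrite -[ltRHS]e ltrDr invr_gt0.
have eM : circle_val (Circle xP *+ n.+1) = n.+2%:R^-1 *+ n.+1.
  by rewrite circle_valMn.
rewrite (mulrS (Circle xP)); apply: val_inj.
by rewrite /GRing.add /= eM e ltxx subrr.
Qed.

(** Divisibility suffices because ideals of the integers are principal: the domain of G is zero or
    generated by its least positive element. *)
Lemma circle_baer : baer [set: zmodule circle].
Proof.
move=> G G_lin _; have [[G0 GD GZ] Gf] := G_lin.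
have GZ' (r x : int) e : G x e -> G (r * x) (r *: e) by exact: (GZ r (x, e)).
have GD' (x y : int) e e' : G x e -> G y e' -> G (x + y) (e + e').
  exact: (GD (x, e) (y, e')).
have Ginj := partial_linear_inj G_lin.
have [[n0 hn0]|none] := pselect (exists n, exists c, G n.+1%:Z c); last first.
  exists 0 => // r c Grc; rewrite scaler0; suff r0 : r = 0.
    by apply/esym/Gf; rewrite -r0.
  apply: contrapT => /eqP rn0; apply: none.
  case: r rn0 Grc => [[|n] //|n] _ Grc; first by exists n, c.
  by exists n, (- 1 *: c); rewrite -[n.+1%:Z]mul1r -[1]opprK mulNr -mulrN -NegzE;
    apply: GZ'.
have ex : exists n, `[< exists c, G n.+1%:Z c >] by exists n0; apply/asboolP.
case: (ex_minnP ex) => n /asboolP[c Gnc] nmin.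
have [e he] := circle_divisible (c : circle) n.
exists e => // r c' Grc'.
have rq : (r = (r %/ n.+1)%Z * n.+1)%R.
  rewrite {1}(divz_eq r n.+1) -[RHS]addr0; congr (_ + _).
  have : (0 <= (r %% n.+1)%Z)%R by rewrite modz_ge0.
  have : ((r %% n.+1)%Z < n.+1)%R by rewrite ltz_pmod.
  have : exists c, G (r %% n.+1)%Z c.
    exists (c' + (- (r %/ n.+1)%Z) *: c).
    have -> : (r %% n.+1)%Z = r + (- (r %/ n.+1)%Z) * n.+1%:Z.
      by rewrite {2}(divz_eq r n.+1) mulNr addrAC subrr add0r.
    by apply: GD' => //; exact: GZ'.
  case: (r %% n.+1)%Z => // -[//|k] Gk; rewrite ltz_nat ltnS => kn _.
  have := nmin k; rewrite leqNgt kn => h.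
  by have // := h; move/(_ (asboolT Gk)).
apply: (Ginj _ _ _ _ Grc').
have -> : r *: (e : zmodule circle) = (r %/ n.+1)%Z *: (c : zmodule circle).
  rewrite {1}rq -scalerA; congr (_ *: _).
  by rewrite -he.
by rewrite {1}rq; apply: GZ'.
Qed.

Definition character (V : zmodType) (h : V -> circle) : Prop :=
  forall x y, h (x + y) = h x + h y.

Lemma character_extension (V : zmodType) (G : V -> circle -> Prop) :
  G 0 0 -> (forall x y e f, G x e -> G y f -> G (x - y) (e - f)) ->
  (forall e, G 0 e -> e = 0) ->
  exists h, character h /\ forall b e, G b e -> h b = e.
Proof.
move=> G0 GB Gf.
have GN x e : G x e -> G (- x) (- e) by rewrite -(sub0r x) -(sub0r e); exact: GB.
have GD x y e f : G x e -> G y f -> G (x + y) (e + f).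
  by move=> h1 h2; rewrite -(opprK y) -(opprK f); apply/GB/GN.
have GM x e n : G x e -> G (x *+ n) (e *+ n).
  by move=> h; elim: n => [//|n IHn]; rewrite !mulrS; apply: GD.
have [|//|h [_ hG]] :=
    @baer_partial _ _ _ (submoduleT (zmodule circle)) circle_baer (zmodule V) G.
  split; [split|] => //=; first by move=> [x1 x2] [y1 y2]; exact: GD.
  move=> [n|n] [x1 x2] /= h; first exact: GM.
  by apply: GN; apply: GM.
by exists h; split=> // x y; exact: (raddfD h).
Qed.

(** Modulo N, the subgroup generated by x has a character that is non-zero at x: send x to a
    non-zero element of Q/Z killed by the order of x, or to any non-zero element if the order is
    infinite. It extends since Q/Z is injective over the integers. *)
Lemma character_separation (V : zmodType) (N : set V) (x : V) :
  N 0 -> (forall y z, N y -> N z -> N (y - z)) -> ~ N x ->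
  exists h, [/\ character h, (forall y, N y -> h y = 0) & h x <> 0].
Proof.
move=> N0 NB Nx.
have NN y : N y -> N (- y) by rewrite -sub0r; exact: NB.
have ND y z : N y -> N z -> N (y + z).
  by move=> h1 h2; rewrite -(opprK z); apply/NB/NN.
have NM y n : N y -> N (y *+ n).
  by move=> h; elim: n => [//|n IHn]; rewrite mulrS; apply: ND.
have [c cn0 hc] : exists2 c : circle, c != 0 & forall n, N (x *+ n) -> c *+ n = 0.
  have [[n0 hn0]|none] := pselect (exists n, N (x *+ n.+1)); last first.
    have [c cn0 _] := circle_torsion 0; exists c => // -[|n] // hn.
    by case: none; exists n.
  have ex : exists n, `[< N (x *+ n.+1) >] by exists n0; apply/asboolP.
  case: (ex_minnP ex) => -[|n] /asboolP hn nmin; first by rewrite mulr1n in hn.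
  have [c cn0 c0] := circle_torsion n; exists c => // k hk.
  rewrite (divn_eq k n.+2) mulrnDr mulnC mulrnA c0 mul0rn add0r.
  have : N (x *+ (k %% n.+2)).
    have -> : x *+ (k %% n.+2) = x *+ k - x *+ n.+2 *+ (k %/ n.+2).
      by rewrite {2}(divn_eq k n.+2) mulrnDr -mulrnA mulnC addrAC subrr add0r.
    by apply: NB => //; apply: NM.
  have : (k %% n.+2 < n.+2)%N by rewrite ltn_mod.
  case: (k %% n.+2)%N => [//|l]; rewrite ltnS => ln hl.
  have := nmin l; rewrite leqNgt ln => h.
  by have // := h; move/(_ (asboolT hl)).
have hc' (k : int) : N (x *~ k) -> c *~ k = 0.
  case: k => n; first exact: hc.
  by rewrite !NegzE !mulrNz -!pmulrn => /NN; rewrite opprK => /hc ->; rewrite oppr0.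
pose G y e := exists k : int, N (y - x *~ k) /\ e = c *~ k.
have [|||h [hC hG]] := @character_extension V G.
- by exists 0; rewrite !mulr0z subr0.
- move=> y z _ _ [k [h1 ->]] [l [h2 ->]]; exists (k - l).
  rewrite !mulrzBr; split=> //.
  have -> : y - z - (x *~ k - x *~ l) = (y - x *~ k) - (z - x *~ l).
    by rewrite !opprB addrACA [RHS]addrACA [- z - _]addrC.
  exact: NB.
- move=> _ [k [h ->]]; apply: hc'; rewrite sub0r in h.
  by rewrite -[_ *~ _]opprK; apply: NN.
exists h; split=> //; last first.
  rewrite (hG x c); first exact/eqP.
  by exists 1; rewrite !mulr1z subrr.
by move=> y Ny; apply: hG; exists 0; rewrite !mulr0z subr0.
Qed.

(** * Coinduced modules and enough injectives *)

Section Coinduced.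
Variables (R : comNzRingType) (X : Type).

(* [Hom_Z(R, Q/Z)^X] with [R] acting on the arguments *)
Record coinduced := Coinduced
  { coind_fun : X -> R -> circle; _ : forall i, character (coind_fun i) }.

HB.instance Definition _ := gen_eqMixin coinduced.
HB.instance Definition _ := gen_choiceMixin coinduced.

Lemma coind_char (F : coinduced) i : character (coind_fun F i).
Proof. by case: F. Qed.

Lemma coindP (F G : coinduced) :
  (forall i s, coind_fun F i s = coind_fun G i s) -> F = G.
Proof.
case: F G => [f hf] [g hg] /= h.
have fg : f = g by apply/funext => i; apply/funext => s; exact: h.
by subst g; congr Coinduced; exact: Prop_irrelevance.
Qed.

Definition coind0 : coinduced :=
  @Coinduced (fun _ _ => 0) (fun _ _ _ => esym (addr0 0)).

Lemma coind_add_subproof (F G : coinduced) i :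
  character (fun s => coind_fun F i s + coind_fun G i s).
Proof. by move=> s t; rewrite !coind_char addrACA. Qed.
Definition coind_add F G := Coinduced (coind_add_subproof F G).

Lemma coind_opp_subproof (F : coinduced) i :
  character (fun s => - coind_fun F i s).
Proof. by move=> s t; rewrite coind_char opprD. Qed.
Definition coind_opp F := Coinduced (coind_opp_subproof F).

Lemma coind_scale_subproof (r : R) (F : coinduced) i :
  character (fun s => coind_fun F i (s * r)).
Proof. by move=> s t; rewrite mulrDl coind_char. Qed.
Definition coind_scale r F := Coinduced (coind_scale_subproof r F).

Lemma coind_addA : associative coind_add.
Proof. by move=> F G H; apply: coindP => i s /=; rewrite addrA. Qed.
Lemma coind_addC : commutative coind_add.
Proof. by move=> F G; apply: coindP => i s /=; rewrite addrC. Qed.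
Lemma coind_add0 : left_id coind0 coind_add.
Proof. by move=> F; apply: coindP => i s /=; rewrite add0r. Qed.
Lemma coind_addN : left_inverse coind0 coind_opp coind_add.
Proof. by move=> F; apply: coindP => i s /=; rewrite addNr. Qed.

HB.instance Definition _ := GRing.isZmodule.Build coinduced
  coind_addA coind_addC coind_add0 coind_addN.

Lemma coind_scaleA a b v : coind_scale a (coind_scale b v) = coind_scale (a * b) v.
Proof. by apply: coindP => i s /=; rewrite mulrA. Qed.
Lemma coind_scale1 : left_id 1 coind_scale.
Proof. by move=> v; apply: coindP => i s /=; rewrite mulr1. Qed.
Lemma coind_scaleDr : right_distributive coind_scale +%R.
Proof. by move=> r u v; apply: coindP. Qed.
Lemma coind_scaleDl v : {morph coind_scale^~ v : a b / a + b}.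
Proof. by move=> a b; apply: coindP => i s /=; rewrite mulrDr coind_char. Qed.

HB.instance Definition _ := GRing.Zmodule_isLmodule.Build R coinduced
  coind_scaleA coind_scale1 coind_scaleDr coind_scaleDl.

Lemma coind_scaleE (r : R) (F : coinduced) i s :
  coind_fun (r *: F) i s = coind_fun F i (s * r).
Proof. by []. Qed.

Lemma coind_addE (F G : coinduced) i s :
  coind_fun (F + G) i s = coind_fun F i s + coind_fun G i s.
Proof. by []. Qed.

(** By adjunction: evaluation at 1 turns a linear map from an ideal into a family of additive maps
    to Q/Z, and these extend to R. *)
Lemma coinduced_injective : injective_module coinduced.
Proof.
apply: baerT_injective => G G_lin _; have [[G0 GD GZ] Gf] := G_lin.
have hC i : exists h : R -> circle, character h /\
    forall r c, G r c -> h r = coind_fun c i 1.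
  have [|||h [h1 h2]] := @character_extension R
      (fun r e => exists2 c, G r c & e = coind_fun c i 1).
  - by exists 0.
  - move=> x y _ _ [c h1 ->] [c' h2 ->]; exists (c - c') => //.
    exact: (@submoduleB _ _ _ (And3 G0 GD GZ) (x, c) (y, c') h1 h2).
  - by move=> _ [c /Gf -> ->].
  by exists h; split=> // r c Grc; apply: h2; exists c.
have {hC}[h hh] := choice hC.
exists (@Coinduced h (fun i => (hh i).1)) => // r c Grc.
apply: coindP => i s; rewrite coind_scaleE /=.
rewrite ((hh i).2 (s * r) (s *: c)); last exact: (GZ s (r, c)).
by rewrite coind_scaleE mul1r.
Qed.

End Coinduced.

(** The quotient M/N embeds into the coinduced module indexed by all characters of M that vanish on
    N. Stating this as a map with kernel N avoids forming the quotient. *)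
Lemma enough_injectives (R : comNzRingType) (M : lmodType R) (N : set M) :
  submodule N -> exists (E : lmodType R) (f : {linear M -> E}),
    injective_module E /\ forall x, f x = 0 <-> N x.
Proof.
move=> N_sub; have [N0 ND NZ] := N_sub.
pose X := {h : M -> circle | character h /\ forall y, N y -> h y = 0}.
have fC (m : M) (i : X) : character (fun s : R => sval i (s *: m)).
  by case: i => h [hC hN] s t /=; rewrite scalerDl hC.
pose f m : coinduced R X := Coinduced (fC m).
have f_lin : linear f.
  move=> a x y; apply: coindP => -[h [hC hN]] s.
  by rewrite coind_addE coind_scaleE /= scalerDr hC scalerA.
pose fm := GRing.isLinear.Build R M _ _ f f_lin.
pose fl : {linear M -> coinduced R X} := HB.pack f fm.
exists (coinduced R X), fl; split; first exact: coinduced_injective.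
move=> x; split=> [fx0|Nx]; last first.
  by apply: coindP => -[h [hC hN]] s /=; apply/hN/NZ.
apply: contrapT => nNx.
have [h [hC hN hx]] := character_separation N0 (submoduleB N_sub) nNx.
apply: hx; have := congr1 (fun F : coinduced R X =>
  coind_fun F (exist _ h (conj hC hN)) 1) fx0.
by rewrite /= scale1r.
Qed.

(** * Ideals, associated primes and prime avoidance *)

Lemma not_subset (T : Type) (A B : set T) : ~ (A `<=` B) -> exists2 x, A x & ~ B x.
Proof.
move=> nAB; apply: contrapT => h; apply: nAB => x Ax; apply: contrapT => nBx.
by apply: h; exists x.
Qed.

Section IdealTheory.
Variable R : comNzRingType.
Implicit Types (I J K a p q : set R) (xs : seq R).

Lemma ideal0 I : ideal I -> I 0. Proof. by case. Qed.
Lemma idealD I x y : ideal I -> I x -> I y -> I (x + y).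
Proof. by case=> _ h _; apply: h. Qed.
Lemma idealM I r x : ideal I -> I x -> I (r * x).
Proof. by case=> _ _; apply. Qed.
Lemma ideal_mulr I r x : ideal I -> I x -> I (x * r).
Proof. by rewrite mulrC; apply: idealM. Qed.
Lemma idealN I x : ideal I -> I x -> I (- x).
Proof. by rewrite -mulN1r; apply: idealM. Qed.
Lemma idealB I x y : ideal I -> I x -> I y -> I (x - y).
Proof. by move=> Ii Ix Iy; apply: idealD => //; apply: idealN. Qed.

Lemma ideal_properE I : ideal I -> (I <> setT) = ~ I 1.
Proof.
move=> Ii; apply/propext; split=> [IT I1|I1 IT]; last by apply: I1; rewrite IT.
by apply: IT; apply/seteqP; split=> // x _; rewrite -[x]mulr1; apply: idealM.
Qed.

Lemma prime_idealW p : prime_ideal p -> ideal p. Proof. by case=> -[]. Qed.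
Lemma prime_ideal1 p : prime_ideal p -> ~ p 1.
Proof. by case=> -[pi pT] _; rewrite -ideal_properE. Qed.

Lemma prime_idealM p x y : prime_ideal p -> ~ p x -> ~ p y -> ~ p (x * y).
Proof. by case=> _ h nx ny /h []. Qed.

Definition add_principal I (y : R) : set R :=
  [set z | exists i r, I i /\ z = i + r * y].

Lemma add_principal_ideal I y : ideal I -> ideal (add_principal I y).
Proof.
move=> Ii; split.
- by exists 0, 0; rewrite mul0r addr0; split=> //; apply: ideal0.
- move=> _ _ [i [r [Ii1 ->]]] [j [s [Ij ->]]]; exists (i + j), (r + s).
  by split; [exact: idealD|ring].
- move=> t _ [i [r [Ii1 ->]]]; exists (t * i), (t * r).
  by split; [exact: idealM|ring].
Qed.

Lemma sub_add_principal I y : I `<=` add_principal I y.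
Proof. by move=> x Ix; exists x, 0; rewrite mul0r addr0. Qed.

Lemma mem_add_principal I y : ideal I -> add_principal I y y.
Proof. by move=> Ii; exists 0, 1; rewrite mul1r add0r; split=> //; apply: ideal0. Qed.

Lemma add_principal_min I J y : ideal J -> I `<=` J -> J y ->
  add_principal I y `<=` J.
Proof.
by move=> Ji IJ Jy _ [i [r [Ii ->]]]; apply: idealD (IJ _ Ii) _ => //; exact: idealM.
Qed.

Lemma colon_ideal I J : ideal I -> ideal (colon I J).
Proof.
move=> Ii; split=> [x _|x y hx hy z Jz|r x hx z Jz].
- by rewrite mul0r; apply: ideal0.
- by rewrite mulrDl; apply: idealD; [|exact: hx|exact: hy].
- by rewrite -mulrA; apply: idealM => //; exact: hx.
Qed.

Definition annihilator I (y : R) : set R := [set r | I (r * y)].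

Lemma annihilator_ideal I y : ideal I -> ideal (annihilator I y).
Proof.
move=> Ii; split; first by rewrite /annihilator /= mul0r; apply: ideal0.
  by move=> r s; rewrite /annihilator /= mulrDl; apply: idealD.
by move=> r s; rewrite /annihilator /= -mulrA; apply: idealM.
Qed.

Lemma sub_annihilator I y : ideal I -> I `<=` annihilator I y.
Proof. by move=> Ii r Ir; rewrite /annihilator /=; apply: ideal_mulr. Qed.

Lemma ideal_gen_ideal xs : ideal (ideal_gen xs).
Proof.
split.
- by exists (fun=> 0); rewrite big1 // => i _; rewrite mul0r.
- move=> _ _ [c ->] [c' ->]; exists (fun i => c i + c' i).
  by rewrite -big_split; apply: eq_bigr => i _; rewrite mulrDl.
- move=> r _ [c ->]; exists (fun i => r * c i).
  by rewrite mulr_sumr; apply: eq_bigr => i _; rewrite mulrA.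
Qed.

Lemma ideal_sum I n (f : 'I_n -> R) : ideal I -> (forall i, I (f i)) -> I (\sum_i f i).
Proof. by move=> [h0 hD _] h; apply: big_ind. Qed.

Lemma ideal_gen_min xs I : ideal I -> [set` xs] `<=` I -> ideal_gen xs `<=` I.
Proof.
move=> Ii xsI _ [c ->]; apply: ideal_sum => // i; apply: idealM => //.
by apply: xsI; rewrite /= mem_nth.
Qed.

Lemma mem_ideal_gen xs : [set` xs] `<=` ideal_gen xs.
Proof.
move=> x /= xxs; have ix : (index x xs < size xs)%N by rewrite index_mem.
exists (fun i => (i == Ordinal ix)%:R).
rewrite (bigD1 (Ordinal ix)) //= eqxx mul1r nth_index // big1 ?addr0 //.
by move=> i /negPf ->; rewrite mul0r.
Qed.

Lemma ideal_gen_nil : ideal_gen [::] = [set 0 : R].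
Proof.
apply/seteqP; split=> [_ [c ->]|_ ->]; first by rewrite big_ord0.
exact: ideal0 (ideal_gen_ideal _).
Qed.

Lemma ideal_gen_rcons xs y : ideal_gen (rcons xs y) = add_principal (ideal_gen xs) y.
Proof.
have xsi := ideal_gen_ideal xs; apply/seteqP; split.
  apply: ideal_gen_min; first exact: add_principal_ideal.
  move=> x; rewrite /= mem_rcons in_cons => /orP[/eqP ->|xx].
    exact: mem_add_principal.
  exact/sub_add_principal/mem_ideal_gen.
apply: add_principal_min; first exact: ideal_gen_ideal.
  apply: ideal_gen_min; first exact: ideal_gen_ideal.
  by move=> x /= xx; apply: mem_ideal_gen; rewrite /= mem_rcons in_cons xx orbT.
by apply: mem_ideal_gen; rewrite /= mem_rcons mem_head.
Qed.

Definition nonzerodivisor I (y : R) : Prop := forall r, I (r * y) -> I r.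

Lemma regular_seq_rcons xs y : regular_seq (rcons xs y) <->
  [/\ regular_seq xs, nonzerodivisor (ideal_gen xs) y
    & ideal_gen (rcons xs y) <> setT].
Proof.
split=> [[h1 h2]|[[h1 h2] h3 h4]].
  split=> //.
    split.
      move=> xsT; apply: h1; apply/seteqP; split=> // x _.
      by rewrite ideal_gen_rcons; apply: sub_add_principal; rewrite xsT.
    move=> i isz r; have := h2 i; rewrite size_rcons ltnS => /(_ (ltnW isz) r).
    by rewrite nth_rcons isz -cats1 takel_cat // ltnW.
  move=> r; have := h2 (size xs); rewrite size_rcons ltnS => /(_ (leqnn _) r).
  by rewrite nth_rcons ltnn eqxx -cats1 take_size_cat // mulrC.
split=> // i; rewrite size_rcons ltnS leq_eqVlt => /orP[/eqP -> r|isz r].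
  by rewrite nth_rcons ltnn eqxx -cats1 take_size_cat // mulrC; apply: h3.
by rewrite nth_rcons isz -cats1 takel_cat 1?ltnW //; exact: (h2 i isz r).
Qed.

Lemma regular_seq_nil : regular_seq ([::] : seq R).
Proof.
split=> //; rewrite ideal_properE; last exact: ideal_gen_ideal.
by rewrite ideal_gen_nil => /= /eqP; rewrite oner_eq0.
Qed.

Section Noetherian.
Hypothesis R_noeth : noetherian R.

(** Without a maximal member, choice yields a strictly increasing chain; its union is finitely
    generated, so some member of the chain is already the union. *)
Lemma noetherian_max (P : set R -> Prop) : (exists J, ideal J /\ P J) ->
  exists J, [/\ ideal J, P J & forall K, ideal K -> P K -> J `<=` K -> K `<=` J].
Proof.
move=> [J0 hJ0]; apply: contrapT => nmax.
pose T := {J : set R | ideal J /\ P J}.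
have step (J : T) : exists K : T, sval J `<=` sval K /\ ~ (sval K `<=` sval J).
  apply: contrapT => nK; apply: nmax; case: J nK => J [Ji PJ] /= nK.
  exists J; split=> // K Ki PK JK; apply: contrapT => nKJ.
  by apply: nK; exists (exist _ K (conj Ki PK)).
have [f hf] := choice step.
pose s n : set R := sval (iter n f (exist _ J0 hJ0)).
have si n : ideal (s n) by rewrite /s; case: (iter _ _ _) => ? [].
have sS n : s n `<=` s n.+1 by have [] := hf (iter n f (exist _ J0 hJ0)).
have sle i j : (i <= j)%N -> s i `<=` s j.
  elim: j => [|j IHj]; first by rewrite leqn0 => /eqP ->.
  rewrite leq_eqVlt => /orP[/eqP -> //|]; rewrite ltnS => /IHj h.
  exact: subset_trans h (sS j).
pose U : set R := [set x | exists n, s n x].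
have Ui : ideal U.
  split; first by exists 0%N; exact: ideal0.
    move=> x y [i hi] [j hj]; exists (maxn i j); apply: idealD => //.
      exact: (sle _ _ (leq_maxl i j)).
    exact: (sle _ _ (leq_maxr i j)).
  by move=> r x [n hn]; exists n; apply: idealM.
have [xs Uxs] := R_noeth Ui.
have [N hN] : exists N, [set` xs] `<=` s N.
  have : [set` xs] `<=` U by rewrite Uxs; exact: mem_ideal_gen.
  elim: (xs) => [|x l IHl] hl; first by exists 0%N => ?.
  have [|N hN] := IHl.
    by move=> z zl; apply: hl; rewrite /= in_cons; apply/orP; right.
  have [|M hM] := hl x; first by rewrite /= mem_head.
  exists (maxn N M) => z; rewrite /= in_cons => /orP[/eqP ->|zl].
    exact: (sle _ _ (leq_maxr N M)).
  by apply: (sle _ _ (leq_maxl N M)); apply: hN.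
have [_] := hf (iter N f (exist _ J0 hJ0)); apply => x hx.
apply: (ideal_gen_min (si N) hN); rewrite -Uxs; exists N.+1; exact: hx.
Qed.

Lemma noetherian_ind (P : set R -> Prop) :
  (forall J, ideal J ->
     (forall K, ideal K -> J `<=` K -> ~ (K `<=` J) -> P K) -> P J) ->
  forall J, ideal J -> P J.
Proof.
move=> step J0 J0i; apply: contrapT => nP.
have [|J [Ji nPJ Jmax]] := @noetherian_max (fun J => ~ P J); first by exists J0.
apply: nPJ; apply: step => // K Ki JK nKJ; apply: contrapT => nPK.
exact/nKJ/Jmax.
Qed.

(** A maximal member among the proper annihilators of multiples of y is prime. *)
Lemma associated_multiple I y : ideal I -> ~ I y ->
  exists r, prime_ideal (annihilator I (r * y)).
Proof.
move=> Ii nIy.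
have [|J [Ji [r [Jr nJ1]] Jmax]] := @noetherian_max
    (fun J => exists r, J = annihilator I (r * y) /\ ~ J 1).
  exists (annihilator I (1 * y)); split; first exact: annihilator_ideal.
  by exists 1; split=> //; rewrite /annihilator /= !mul1r.
exists r; rewrite -Jr; split; first by split; rewrite ?ideal_properE.
move=> s t Jst; apply: contrapT => /not_orP[nJs nJt]; apply: nJt.
apply: (Jmax (annihilator I (s * r * y))); first exact: annihilator_ideal.
- exists (s * r); split=> //; rewrite /annihilator /= mul1r => h; apply: nJs.
  by rewrite Jr /annihilator /= mulrA.
- rewrite Jr /annihilator => z /= h.
  have -> : z * (s * r * y) = s * (z * (r * y)) by ring.
  exact: idealM.
- move: Jst; rewrite Jr /annihilator /=; congr I; ring.
Qed.

(** This is the existence of associated primes after localization at q: an ideal (I : z) maximal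
    among those contained in q is prime, because elements outside q are non-zero-divisors modulo it
    ([Jclean]). *)
Lemma associated_below I q : ideal I -> prime_ideal q -> I `<=` q ->
  exists z, prime_ideal (annihilator I z) /\ annihilator I z `<=` q.
Proof.
move=> Ii qp Iq; have qi := prime_idealW qp.
have [|J [Ji [z [Jz Jq]] Jmax]] := @noetherian_max
    (fun J => exists z, J = annihilator I z /\ J `<=` q).
  exists (annihilator I 1); split; first exact: annihilator_ideal.
  by exists 1; split=> // r; rewrite /annihilator /= mulr1; apply: Iq.
have Jclean s r : ~ q s -> J (r * s) -> J r.
  move=> nqs Jrs; apply: (Jmax (annihilator I (s * z))); first exact: annihilator_ideal.
  - exists (s * z); split=> // t; rewrite /annihilator /= => h.
    have : q (t * s) by apply: Jq; rewrite Jz /annihilator /= -mulrA.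
    by case: qp => _ h' /h' [].
  - rewrite Jz /annihilator => t /= h; have -> : t * (s * z) = s * (t * z) by ring.
    exact: idealM.
  - by move: Jrs; rewrite Jz /annihilator /= mulrA.
exists z; rewrite -Jz; split=> //; split.
  by split=> //; rewrite ideal_properE // => /Jq; apply: prime_ideal1.
move=> s t Jst; apply: contrapT => /not_orP[nJs nJt]; apply: nJs.
apply: (Jmax (annihilator I (t * z))); first exact: annihilator_ideal.
- exists (t * z); split=> // r; rewrite /annihilator /= => h.
  apply: contrapT => nqr; apply: nJt; apply: (Jclean r) => //.
  by rewrite Jz /annihilator /= [t * r]mulrC -mulrA.
- rewrite Jz /annihilator => r /= h; have -> : r * (t * z) = t * (r * z) by ring.
  exact: idealM.
- by move: Jst; rewrite Jz /annihilator /= mulrA.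
Qed.

(** Let (J : y) be an associated prime. For another one (J : z), either some multiple of z lies in J
    + Ry but not in J, and then (J : z) = (J : y), or none does, and then (J : z) = (J + Ry : z),
    which the induction covers. *)
Lemma associated_finite I : ideal I -> exists l : seq (set R),
  (forall p, p \in l -> prime_ideal p) /\
  forall z, prime_ideal (annihilator I z) -> annihilator I z \in l.
Proof.
move: I; apply: noetherian_ind => J Ji IH.
have [J1|nJ1] := pselect (J 1).
  exists [::]; split=> // z /prime_ideal1 []; rewrite /annihilator /= mul1r.
  by rewrite -[z]mulr1; apply: idealM.
have [r] := associated_multiple Ji nJ1; set y := r * 1 => qp.
have nJy : ~ J y by move=> Jy; apply: (prime_ideal1 qp); rewrite /annihilator /= mul1r.
have [|||l [lp hl]] := IH (add_principal J y).
- exact: add_principal_ideal.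
- exact: sub_add_principal.
- by move=> h; apply/nJy/h/mem_add_principal.
exists (annihilator J y :: l); split=> [p|z zp].
  by rewrite in_cons => /orP[/eqP ->|/lp].
rewrite in_cons; apply/orP.
have [[t [ht1 ht2]]|none] :=
  pselect (exists t, add_principal J y (t * z) /\ ~ J (t * z)).
  left; apply/eqP; case: ht1 => i [s [Ii e]].
  have nqs : ~ annihilator J y s.
    by move=> h; apply: ht2; rewrite e; apply: idealD.
  have nzt : ~ annihilator J z t by [].
  apply/seteqP; split=> v; rewrite /annihilator /= => hv.
    have : annihilator J y (v * s).
      have -> : annihilator J y (v * s) = J (t * (v * z) - v * i).
        rewrite /annihilator /=; congr J.
        rewrite (_ : t * (v * z) = v * (t * z)); last by ring.
        by rewrite e; ring.
      by apply: idealB => //; apply: idealM.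
    by case: qp => _ h /h [].
  have : annihilator J z (v * t).
    rewrite /annihilator /= -mulrA e mulrDr; apply: idealD; first exact.
      exact: idealM.
    have -> : v * (s * y) = s * (v * y) by ring.
    exact: idealM.
  by case: zp => _ h /h [].
right; have -> : annihilator J z = annihilator (add_principal J y) z.
  apply/seteqP; split=> v; rewrite /annihilator /=; first exact: sub_add_principal.
  by move=> h; apply: contrapT => nh; apply: none; exists v.
apply: hl; have -> // : annihilator (add_principal J y) z = annihilator J z.
apply/seteqP; split=> v; rewrite /annihilator /=; last exact: sub_add_principal.
by move=> h; apply: contrapT => nh; apply: none; exists v.
Qed.

End Noetherian.

Lemma prime_avoidance a (l : seq (set R)) : ideal a ->
  (forall p, p \in l -> prime_ideal p /\ ~ (a `<=` p)) ->
  exists2 x, a x & forall p, p \in l -> ~ p x.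
Proof.
move=> ai; move: {2}(size l) (erefl (size l)) => n.
elim: n l => [|n IHn] [|p l] // => [_ _|[szl] hl].
  by exists 0; [exact: ideal0|].
have [pp anp] := hl p (mem_head _ _).
have hl' q : q \in l -> prime_ideal q /\ ~ (a `<=` q).
  by move=> ql; apply: hl; rewrite in_cons ql orbT.
have pi := prime_idealW pp.
have [[p' pl p'p]|none] := pselect (exists2 p', p' \in l & p' `<=` p).
  have [||x ax hx] := IHn (p :: rem p' l).
  - by rewrite /= size_rem // prednK //; case: (l) pl.
  - move=> q; rewrite in_cons => /orP[/eqP -> //|/mem_rem]; exact: hl'.
  exists x => // q; rewrite in_cons => /orP[/eqP ->|ql].
    by apply: hx; rewrite mem_head.
  have [->|nqp'] := eqVneq q p'; first by move=> /p'p; apply: hx; rewrite mem_head.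
  apply: hx; rewrite in_cons; apply/orP; right.
  by move: ql; rewrite (perm_mem (perm_to_rem pl)) in_cons (negPf nqp').
have [x ax hx] := IHn l szl hl'.
have [px|npx] := pselect (p x); last first.
  by exists x => // q; rewrite in_cons => /orP[/eqP -> //|]; exact: hx.
have [w aw npw] := not_subset anp.
(* The element y is a product of one element from each of the other primes, chosen outside p; adding
   w y to x repairs x at p and changes nothing at the others. *)
have [y npy hy] : exists2 y, ~ p y & forall q, q \in l -> q y.
  have : forall q, q \in l -> ~ (q `<=` p) /\ ideal q.
    move=> q ql; split; first by move=> qp; apply: none; exists q.
    by case: (hl' q ql) => /prime_idealW.
  elim: (l) => [|q l' IHl'] hq; first by exists 1; [exact: prime_ideal1|].
  have [|y npy hy] := IHl'.
    by move=> q' h; apply: hq; rewrite in_cons h orbT.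
  have [nqp qi] := hq q (mem_head _ _).
  have [v qv npv] := not_subset nqp.
  exists (v * y); first exact: prime_idealM.
  move=> q'; rewrite in_cons => /orP[/eqP ->|q'l]; first exact: ideal_mulr.
  apply: idealM; last exact: hy.
  by case: (hq q'); rewrite ?in_cons ?q'l ?orbT.
exists (x + w * y); first by apply: idealD => //; exact: ideal_mulr.
move=> q; rewrite in_cons => /orP[/eqP ->|ql] h.
  have : p (w * y) by rewrite -[w * y](addKr x) addrC; apply: idealB.
  exact: prime_idealM.
apply: (hx q ql); have qi : ideal q by case: (hl' q ql) => /prime_idealW.
by rewrite -[x](addrK (w * y)); apply: idealB => //; apply: idealM => //; exact: hy.
Qed.

Lemma zerodivisors_colon I a : noetherian R -> ideal I -> ideal a ->
  (forall y, a y -> ~ nonzerodivisor I y) ->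
  exists w, ~ I w /\ forall x, a x -> I (x * w).
Proof.
move=> R_noeth Ii ai azd.
have [l [lp hl]] := associated_finite R_noeth Ii.
apply: contrapT => nw.
(* The list may hold further primes; only those of the form (I : z) are to be avoided. *)
pose l' := [seq p <- l | `[< exists z, p = annihilator I z >]].
have [|x ax hx] := @prime_avoidance a l' ai.
  move=> p; rewrite mem_filter => /andP[/asboolP[z pz] /lp pp]; split=> // ap.
  apply: nw; exists z; split; last by move=> x /ap; rewrite pz.
  by move=> Iz; apply: (prime_ideal1 pp); rewrite pz /annihilator /= mul1r.
apply: (azd x ax) => r Irx; apply: contrapT => nIr.
have [s sp] := associated_multiple R_noeth Ii nIr.
apply: (hx (annihilator I (s * r))).
  by rewrite mem_filter hl // andbT; apply/asboolP; exists (s * r).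
rewrite /annihilator /=; have -> : x * (s * r) = s * (r * x) by ring.
exact: idealM.
Qed.

(** * Local rings, Nakayama's lemma and submodules of R^n *)

Section Local.
Variable m : set R.
Hypotheses (R_noeth : noetherian R) (R_local : local_ring m).

Lemma local_sub J : ideal J -> ~ J 1 -> J `<=` m.
Proof.
move=> Ji nJ1.
have [|K [Ki [nK1 JK] Kmax]] := @noetherian_max R_noeth (fun K => ~ K 1 /\ J `<=` K).
  by exists J; split=> //; split.
have -> // : m = K.
apply/esym; case: R_local => _; apply; split; first by split; rewrite ?ideal_properE.
move=> L [Li LT] KL; rewrite ideal_properE // in LT.
apply/seteqP; split=> //; apply: Kmax => //; split=> //.
exact: subset_trans KL.
Qed.

Lemma local_ideal : ideal m. Proof. by case: R_local => -[[]]. Qed.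
Lemma local1 : ~ m 1.
Proof. by case: R_local => -[[mi mT] _] _; rewrite -ideal_properE. Qed.

Lemma local_unit s : ~ m s -> exists t, t * s = 1.
Proof.
move=> nms; have zi := ideal_gen_ideal ([::] : seq R).
have [h|nJ1] := pselect (add_principal (ideal_gen [::]) s 1).
  by case: h => i [r [+ ->]]; rewrite ideal_gen_nil => ->; exists r; rewrite add0r.
case: nms; apply: (local_sub _ nJ1); first exact: add_principal_ideal.
exact: mem_add_principal.
Qed.

Lemma local_prime : prime_ideal m.
Proof.
have mi := local_ideal; split.
  by split=> //; rewrite ideal_properE //; exact: local1.
move=> x y mxy; have [mx|/local_unit [t tx]] := pselect (m x); first by left.
by right; rewrite -[y]mul1r -tx -mulrA; apply: idealM.
Qed.

End Local.

(* The determinant trick, localized at [q] *)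
Lemma nakayama (V : lmodType R) (N : set V) q n (v : nat -> V) :
  prime_ideal q -> submodule N ->
  (forall k, (k < n)%N -> exists s, ~ q s /\ exists a : nat -> R,
     (forall j, q (a j)) /\ N (s *: v k - \sum_(j < n) a j *: v j)) ->
  exists s, ~ q s /\ forall k, (k < n)%N -> N (s *: v k).
Proof.
move=> qp Ns; have qi := prime_idealW qp; have [N0 ND NZ] := Ns.
elim: n => [_|n IHn h]; first by exists 1; split=> //; exact: prime_ideal1.
have [s [nqs [a [qa hs]]]] := h n (ltnSn n).
(* The last row expresses [s' *: v n] through the earlier vectors modulo N, with [s'] outside q; it
   eliminates [v n] from the other rows at the cost of a factor [s']. *)
pose s' := s - a n.
have nqs' : ~ q s'.
  by move=> qs'; apply: nqs; rewrite -[s](subrK (a n)); apply: idealD.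
have hs' : N (s' *: v n - \sum_(j < n) a j *: v j).
  move: hs; rewrite big_ord_recr /= scalerBl; congr N.
  by rewrite opprD addrA addrAC.
have [|t [nqt ht]] := IHn.
  move=> k kn; have [t [nqt [b [qb ht]]]] := h k (ltnW kn).
  exists (s' * t); split; first exact: prime_idealM.
  exists (fun j => s' * b j + b n * a j); split.
    by move=> j; apply: idealD => //; apply: idealM.
  have -> : s' * t *: v k - \sum_(j < n) (s' * b j + b n * a j) *: v j =
      s' *: (t *: v k - \sum_(j < n.+1) b j *: v j)
      + b n *: (s' *: v n - \sum_(j < n) a j *: v j).
    rewrite big_ord_recr /= !scalerBr scalerDr !scalerA !scaler_sumr.
    rewrite (eq_bigr (fun j : 'I_n => (s' * b j) *: v j + (b n * a j) *: v j));
      last by move=> j _; rewrite scalerDl.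
    rewrite big_split /= (eq_bigr (fun j : 'I_n => s' *: (b j *: v j))); last first.
      by move=> j _; rewrite scalerA.
    rewrite [X in _ - (_ + X)](eq_bigr (fun j : 'I_n => b n *: (a j *: v j)));
      last by move=> j _; rewrite scalerA.
    rewrite [s' * b n]mulrC !opprD !addrA; congr (_ - _).
    by rewrite addrNK.
  by apply: ND; apply: NZ.
exists (t * s'); split; first exact: prime_idealM.
move=> k; rewrite ltnS leq_eqVlt => /orP[/eqP ->|kn]; last first.
  by rewrite mulrC -scalerA; apply/NZ/ht.
rewrite -scalerA -[s' *: v n](subrK (\sum_(j < n) a j *: v j)) scalerDr.
apply: ND; first exact: NZ.
rewrite scaler_sumr; apply: submodule_sum => // j.
by rewrite scalerA mulrC -scalerA; apply/NZ/ht.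
Qed.

(** Vectors of R^n are functions of which only the first n values count. Generators are those of the
    part with vanishing last coordinate, followed by lifts of generators of the ideal of last
    coordinates. *)
Lemma noetherian_vectors n (K : set (nat -> R^o)) : noetherian R -> submodule K ->
  exists l (A : nat -> nat -> R), (forall i, (i < l)%N -> K (A i)) /\
    forall k, K k -> exists c : nat -> R,
      forall j, (j < n)%N -> k j = \sum_(i < l) c i * A i j.
Proof.
move=> R_noeth; elim: n K => [|n IHn] K Ks.
  by exists 0%N, (fun _ _ => 0); split=> // k Kk; exists (fun=> 0).
have [K0 KD KZ] := Ks.
have Ci : ideal [set x | exists2 k, K k & x = k n].
  split; first by exists 0.
    by move=> _ _ [k Kk ->] [k' Kk' ->]; exists (k + k') => //; apply: KD.
  by move=> r _ [k Kk ->]; exists (r *: k) => //; apply: KZ.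
have [xs Cxs] := R_noeth _ Ci.
have hB i : exists k, K k /\ ((i < size xs)%N -> xs`_i = k n).
  have [isz|] := boolP (i < size xs)%N; last by exists 0.
  have : ideal_gen xs xs`_i by apply: mem_ideal_gen; rewrite /= mem_nth.
  by rewrite -Cxs => -[k Kk e]; exists k.
have [B {}hB] := choice hB.
have [|l [A [KA hA]]] := IHn [set k | K k /\ k n = 0].
  split; first by split.
    by move=> x y [Kx x0] [Ky y0]; split; [exact: KD|rewrite addrfctE x0 y0 addr0].
  by move=> r x [Kx x0]; split; [exact: KZ|rewrite scalrfctE x0 scaler0].
exists (l + size xs)%N, (fun i => if (i < l)%N then A i else B (i - l)%N).
split=> [i _|k Kk]; first by case: ifP => [/KA []|_] //; case: (hB (i - l)%N).
have : ideal_gen xs (k n) by rewrite -Cxs; exists k.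
case=> b hb.
pose c0 i := if insub i is Some i' then b i' else 0.
pose k' : nat -> R^o := k - \sum_(i < size xs) c0 i *: B i.
have sumB j : (\sum_(i < size xs) c0 i *: B i : nat -> R^o) j
    = \sum_(i < size xs) c0 i * B i j.
  by elim/big_rec2: _ => // i y1 y2 _ <-.
have k'n : k' n = 0.
  rewrite /k' addrfctE opprfctE /= sumB hb; apply/eqP; rewrite subr_eq0; apply/eqP.
  apply: eq_bigr => i _; rewrite /c0 insubT // => isz.
  by have [_ <- //] := hB i; congr (b _ * _); apply: val_inj.
have [|c hc] := hA k'.
  split=> //; apply: submoduleB => //; apply: submodule_sum => // i.
  by apply: KZ; case: (hB i).
exists (fun i => if (i < l)%N then c i else c0 (i - l)%N) => j jn.
rewrite big_split_ord /=.
rewrite [X in _ = X + _](_ : _ = k' j); last first.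
  have -> : k' j = \sum_(i < l) c i * A i j.
    move: jn; rewrite ltnS leq_eqVlt => /orP[/eqP ->|]; last exact: hc.
    by rewrite k'n big1 // => i _; have [_ ->] := KA i (ltn_ord i); rewrite mulr0.
  by apply: eq_bigr => i _; rewrite ltn_ord.
rewrite /k' addrfctE opprfctE /= sumB.
under [X in _ = _ + X]eq_bigr do rewrite ltnNge leq_addr /= addKn.
by rewrite subrK.
Qed.

End IdealTheory.

(** * Torsion in injective modules *)

Section Killed.
Variables (R : comNzRingType).
Implicit Types (V W : lmodType R) (J K : set R).

(** Stands for Hom(R/J, V), a map being recorded by its value at 1. *)
Definition killed V J (x : V) : Prop := forall r, J r -> r *: x = 0.

Lemma killed_submodule V J : submodule (@killed V J).
Proof.
split=> [r _|x y hx hy r Jr|s x hx r Jr]; first exact: scaler0.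
  by rewrite scalerDr hx // hy // addr0.
by rewrite scalerA mulrC -scalerA hx // scaler0.
Qed.

Lemma killed0 V J : killed J (0 : V). Proof. by case: (killed_submodule V J). Qed.
Lemma killedD V J (x y : V) : killed J x -> killed J y -> killed J (x + y).
Proof. by case: (killed_submodule V J) => _ h _; apply: h. Qed.
Lemma killedB V J (x y : V) : killed J x -> killed J y -> killed J (x - y).
Proof. exact: submoduleB (killed_submodule V J) _ _. Qed.
Lemma killedZ V J r (x : V) : killed J x -> killed J (r *: x).
Proof. by case: (killed_submodule V J) => _ _ h; apply: h. Qed.

Lemma killed_map V W J (f : {linear V -> W}) x : killed J x -> killed J (f x).
Proof. by move=> h r Jr; rewrite -linearZ_LR h // raddf0. Qed.

Lemma killedS V J K (x : V) : J `<=` K -> killed K x -> killed J x.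
Proof. by move=> JK h r /JK; apply: h. Qed.

Lemma killed_add_principal V J y (x : V) :
  killed J x -> y *: x = 0 -> killed (add_principal J y) x.
Proof.
move=> h yx _ [i [r [Ji ->]]].
by rewrite scalerDl h // add0r -scalerA yx scaler0.
Qed.

Lemma killed_annihilator V J y (x : V) :
  killed J x -> killed (annihilator J y) (y *: x).
Proof. by move=> h r Jr; rewrite scalerA; apply: h. Qed.

(** Exactness of Hom(-, V) on the injection R/(J : y) -> R/J given by y: the map that kills J and
    sends y to u is extended from J + Ry to R, and w is the image of 1. *)
Lemma injective_divide V J y (u : V) : injective_module V -> ideal J ->
  killed (annihilator J y) u -> exists w, killed J w /\ y *: w = u.
Proof.
move=> Vinj Ji hu.
pose G (r : R^o) (c : V) := exists s, J (r - s * y) /\ c = s *: u.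
have [|h hG] := @injective_partial R R^o V G _ Vinj.
  split; [split|] => /=.
  - by exists 0; rewrite mul0r scale0r subr0; split=> //; apply: ideal0.
  - move=> [r c] [r' c'] [s [h1 /= ->]] [s' [h2 /= ->]]; exists (s + s').
    rewrite scalerDl; split=> //.
    have -> : r + r' - (s + s') * y = (r - s * y) + (r' - s' * y) by ring.
    exact: idealD.
  - move=> t [r c] [s [h1 /= ->]]; exists (t * s); rewrite scalerA; split=> //.
    by rewrite -mulrA -mulrBr; apply: idealM.
  - move=> e [s [h1 ->]]; apply: hu; rewrite /annihilator /=.
    by rewrite -[_ * _]opprK; apply: idealN => //; rewrite -sub0r.
have hE r : h r = r *: h (1 : R^o).
  by rewrite -linearZ_LR; congr (h _); rewrite -[RHS]/(r * 1) mulr1.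
exists (h (1 : R^o)); split=> [r Jr|]; rewrite -hE.
  by apply: hG; exists 0; rewrite mul0r scale0r subr0.
by apply: hG; exists 1; rewrite mul1r scale1r subrr; split=> //; apply: ideal0.
Qed.

(* If [x] satisfies the linear relations between the rows of [A] then it lifts *)
(* along [A].                                                                  *)
Lemma injective_lift V (A : nat -> nat -> R) l n (x : nat -> V) :
  injective_module V ->
  (forall v : nat -> R^o,
     (forall i, (i < n)%N -> \sum_(a < l) v a * A a i = 0) ->
     \sum_(a < l) v a *: x a = 0) ->
  exists g : nat -> V, forall a, (a < l)%N -> \sum_(i < n) A a i *: g i = x a.
Proof.
move=> Vinj hx.
pose comb (t : nat -> R^o) : nat -> R^o :=
  fun i => if (i < n)%N then \sum_(a < l) t a * A a i else 0.
pose G (v : nat -> R^o) (y : V) :=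
  exists t : nat -> R^o, v = comb t /\ y = \sum_(a < l) t a *: x a.
have [|h hG] := @injective_partial R _ V G _ Vinj.
  split; [split|] => /=.
  - exists 0; split; last by rewrite big1 // => a _; rewrite scale0r.
    apply/funext => i; rewrite /comb; case: ifP => // _.
    by rewrite big1 // => a _; rewrite mul0r.
  - move=> [v y] [v' y'] [t [/= -> ->]] [t' [/= -> ->]]; exists (t + t'); split.
      apply/funext => i; rewrite [LHS](_ : _ = comb t i + comb t' i) // /comb.
      case: ifP => _; last by rewrite addr0.
      by rewrite -big_split; apply: eq_bigr => a _; rewrite addrfctE mulrDl.
    by rewrite -big_split; apply: eq_bigr => a _; rewrite addrfctE scalerDl.
  - move=> r [v y] [t [/= -> ->]]; exists (r *: t); split.
      apply/funext => i; rewrite [LHS](_ : _ = r * comb t i) // /comb.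
      case: ifP => _; last by rewrite mulr0.
      rewrite mulr_sumr; apply: eq_bigr => a _.
      by rewrite scalrfctE mulrA.
    by rewrite scaler_sumr; apply: eq_bigr => a _; rewrite scalrfctE scalerA.
  - move=> e [t [/esym t0 ->]]; apply: hx => i isz.
    by have := congr1 (fun f : nat -> R^o => f i) t0; rewrite /comb isz.
pose delta i : nat -> R^o := fun j => (j == i)%:R.
exists (fun i => h (delta i)) => a al.
pose v : nat -> R^o := comb (delta a).
have vE i : (i < n)%N -> v i = A a i.
  move=> isz; rewrite /v /comb isz (bigD1 (Ordinal al)) //= /delta eqxx mul1r.
  rewrite big1 ?addr0 // => b; rewrite -val_eqE /= => /negPf ->.
  by rewrite mul0r.
have <- : h v = x a.
  apply: hG; exists (delta a); split=> //.
  rewrite (bigD1 (Ordinal al)) //= /delta eqxx scale1r.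
  rewrite big1 ?addr0 // => b; rewrite -val_eqE /= => /negPf ->.
  by rewrite scale0r.
have -> : v = \sum_(i < n) A a i *: delta i.
  apply/funext => j.
  have -> : (\sum_(i < n) A a i *: delta i : nat -> R^o) j
      = \sum_(i < n) A a i * delta i j.
    by elim/big_rec2: _ => // i y1 y2 _ <-.
  have [jn|nj] := ltnP j n.
    rewrite (bigD1 (Ordinal jn)) //= /delta eqxx mulr1 big1 ?addr0 ?vE //.
    by move=> i; rewrite -val_eqE /= eq_sym => /negPf ->; rewrite mulr0.
  rewrite /v /comb ltnNge nj /= big1 // => i _; rewrite /delta gtn_eqF ?mulr0 //.
  exact: leq_trans (ltn_ord i) nj.
by rewrite linear_sum; apply: eq_bigr => i _; rewrite linearZ_LR.
Qed.

End Killed.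

(** * Ext modules of cyclic modules and their localizations *)

Section Cohomology.
Variables (R : comNzRingType).
Implicit Types (I J K p q : set R).

(* [0 -> R -> F 1 -> F 2 -> ...] is an injective resolution; the shift, with   *)
(* [F 0 = 0], makes the boundaries uniform in all degrees. [w] is the image    *)
(* of [1].                                                                     *)
Definition resolves (F : nat -> lmodType R) (d : forall i, {linear F i -> F i.+1})
    (w : F 1%N) : Prop :=
  [/\ (forall x : F 0%N, x = 0), (forall i, injective_module (F i)),
      (forall r, r *: w = 0 -> r = 0),
      (forall x : F 1%N, d 1%N x = 0 <-> exists r, x = r *: w)
    & (forall i (x : F i.+2), d i.+2 x = 0 <-> exists y, x = d i.+1 y)].

Variables (F : nat -> lmodType R) (d : forall i, {linear F i -> F i.+1}) (w : F 1%N).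
Arguments d : clear implicits.
Hypothesis F_res : resolves d w.

Lemma res_injective i : injective_module (F i). Proof. by case: F_res. Qed.
Arguments res_injective : clear implicits.
Lemma res0 (x : F 0%N) : x = 0. Proof. by case: F_res => h _ _ _ _; apply: h. Qed.

Lemma res_dd i x : d i.+1 (d i x) = 0.
Proof.
case: F_res => _ _ _ _ h.
by case: i x => [|i] x; [rewrite (res0 x) !raddf0|apply/h; exists x].
Qed.

(* [Ext^j(R/J, R)] is the quotient of [cocycle j J] by [coboundary j J] *)
Definition cocycle j J (c : F j.+1) : Prop := killed J c /\ d j.+1 c = 0.
Definition coboundary j J (c : F j.+1) : Prop := exists u, killed J u /\ c = d j u.
Arguments cocycle : clear implicits.
Arguments coboundary : clear implicits.

(** Each class is killed by an element outside q: for q prime, this is the vanishing of Ext^j(R/J,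
    R) localized at q. *)
Definition ext_vanish q j J : Prop :=
  forall c, cocycle j J c -> exists s, ~ q s /\ coboundary j J (s *: c).

Lemma cocycle_submodule j J : submodule (cocycle j J).
Proof.
split=> [|x y [h1 h2] [h3 h4]|r x [h1 h2]].
- by split; [exact: killed0|rewrite raddf0].
- by split; [exact: killedD|rewrite linearD h2 h4 addr0].
- by split; [exact: killedZ|rewrite linearZ_LR h2 scaler0].
Qed.

Lemma coboundary_submodule j J : submodule (coboundary j J).
Proof.
split=> [|x y [u [h1 ->]] [v [h2 ->]]|r x [u [h1 ->]]].
- by exists 0; rewrite raddf0; split=> //; exact: killed0.
- by exists (u + v); rewrite linearD; split=> //; exact: killedD.
- by exists (r *: u); rewrite linearZ_LR; split=> //; exact: killedZ.
Qed.

Lemma cocycleB j J c c' : cocycle j J c -> cocycle j J c' -> cocycle j J (c - c').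
Proof. exact: submoduleB (cocycle_submodule j J) _ _. Qed.
Lemma cocycleZ j J r c : cocycle j J c -> cocycle j J (r *: c).
Proof. by case: (cocycle_submodule j J) => _ _; apply. Qed.
Lemma coboundaryZ j J r c : coboundary j J c -> coboundary j J (r *: c).
Proof. by case: (coboundary_submodule j J) => _ _; apply. Qed.

Lemma cocycle_d j J x : killed J x -> cocycle j J (d j x).
Proof. by move=> h; split; [exact: killed_map|exact: res_dd]. Qed.

Lemma coboundaryS j J K c : J `<=` K -> coboundary j K c -> coboundary j J c.
Proof. by move=> JK [u [hu ->]]; exists u; split=> //; exact: killedS hu. Qed.

Lemma ext_vanishW q p j J : p `<=` q -> ext_vanish q j J -> ext_vanish p j J.
Proof.
move=> pq h c /h [s [nqs hs]]; exists s; split=> //; apply: contra_not nqs; exact: pq.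
Qed.

(* Exactness at the middle term of the long exact sequence of                  *)
(* [0 -> R/(J : y) --y--> R/J -> R/(J + y) -> 0].                              *)
Lemma ext_exact_middle q j J y c : prime_ideal q -> ideal J ->
  cocycle j J c -> coboundary j (annihilator J y) (y *: c) ->
  ext_vanish q j (add_principal J y) ->
  exists s, ~ q s /\ coboundary j J (s *: c).
Proof.
move=> qp Ji cJ [u [hu yc]] van.
have [v [hv yv]] := injective_divide (res_injective j) Ji hu.
have [|s [nqs [u' [hu' e]]]] := van (c - d j v).
  have [h1 h2] := cocycleB cJ (cocycle_d hv).
  split=> //; apply: killed_add_principal => //.
  by rewrite scalerBr yc -linearZ_LR yv subrr.
exists s; split=> //; exists (u' + s *: v); split.
  apply: killedD; last exact: killedZ.
  by apply: killedS hu'; exact: sub_add_principal.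
by rewrite linearD linearZ_LR -e scalerBr subrK.
Qed.

(* Exactness at the term of [R/(J : y)]. *)
Lemma ext_exact_connecting q j J y c : ideal J ->
  ext_vanish q j.+1 (add_principal J y) -> cocycle j (annihilator J y) c ->
  exists s, ~ q s /\ exists c', cocycle j J c' /\ s *: c = y *: c'.
Proof.
move=> Ji van [hc dc].
have [v [hv yv]] := injective_divide (res_injective j.+1) Ji hc.
have [|s [nqs [u [hu e]]]] := van (d j.+1 v).
  have [h1 h2] := cocycle_d hv; split=> //; apply: killed_add_principal => //.
  by rewrite -linearZ_LR yv.
exists s; split=> //; exists (s *: v - u); split.
  split; last by rewrite raddfB /= linearZ_LR e subrr.
  apply: killedB; first exact: killedZ.
  by apply: killedS hu; exact: sub_add_principal.
rewrite scalerBr (hu y) ?subr0; last exact: mem_add_principal.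
by rewrite scalerA mulrC -scalerA yv.
Qed.

(* Exactness at the term of [R/(J + y)]. *)
Lemma ext_exact_quotient j J y c : ideal J ->
  (forall e, cocycle j (annihilator J y) e -> exists e',
     cocycle j J e' /\ coboundary j (annihilator J y) (e - y *: e')) ->
  cocycle j.+1 (add_principal J y) c -> coboundary j.+1 J c ->
  coboundary j.+1 (add_principal J y) c.
Proof.
move=> Ji onto [hc dc] [u [hu cu]].
(* The connecting map sends the class of [y *: u] to that of c. By hypothesis [y *: u] comes from a
   class over J, so the image is zero. *)
have [|e' [[he' de'] [v [hv ev]]]] := onto (y *: u).
  split; first exact: killed_annihilator.
  by rewrite linearZ_LR -cu hc //; exact: mem_add_principal.
have [v' [hv' yv']] := injective_divide (res_injective j) Ji hv.
exists (u - e' - d j v'); split; last first.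
  by rewrite !raddfB /= de' res_dd !subr0.
apply: killed_add_principal.
  by apply: killedB; [exact: killedB|exact: killed_map].
by rewrite !scalerBr -linearZ_LR yv' -ev subrr.
Qed.

Section FiniteGeneration.
Hypothesis R_noeth : noetherian R.

(* [Ext^j(R^n/K, R)] is finitely generated: by dimension shifting along        *)
(* [0 -> K -> R^n -> R^n/K -> 0] this reduces to [Hom(R^m/K', R)].             *)
Lemma ext_finite_vectors j n (K : set (nat -> R^o)) : submodule K ->
  exists l (c : nat -> nat -> F j.+1),
    (forall a, (a < l)%N -> (forall i, (i < n)%N -> d j.+1 (c a i) = 0) /\
       forall k, K k -> \sum_(i < n) k i *: c a i = 0) /\
    forall e : nat -> F j.+1, (forall i, (i < n)%N -> d j.+1 (e i) = 0) ->
      (forall k, K k -> \sum_(i < n) k i *: e i = 0) ->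
      exists (b : nat -> R) (u : nat -> F j),
        (forall k, K k -> \sum_(i < n) k i *: u i = 0) /\
        forall i, (i < n)%N -> e i = \sum_(a < l) b a *: c a i + d j (u i).
Proof.
case: F_res => _ _ w_free ex1 ex.
elim: j n K => [|j IHj] n K Ks.
  (* L is Hom(R^n/K, R). *)
  pose L : set (nat -> R^o) := [set r | forall k, K k -> \sum_(i < n) k i * r i = 0].
  have [|l [A [LA hA]]] := @noetherian_vectors R n L R_noeth.
    split=> [k _|x y hx hy k Kk|r x hx k Kk].
    - by rewrite big1 // => i _; rewrite mulr0.
    - under eq_bigr do rewrite addrfctE mulrDr.
      by rewrite big_split /= hx // hy // addr0.
    - rewrite (eq_bigr (fun i : 'I_n => r * (k i * x i))).
        by rewrite -mulr_sumr hx // mulr0.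
      by move=> i _; rewrite mulrCA.
  exists l, (fun a i => A a i *: w); split=> [a al|e de Ke].
    split=> [i _|k Kk]; first by apply/ex1; exists (A a i).
    under eq_bigr do rewrite scalerA.
    by rewrite -scaler_suml LA // scale0r.
  have hr i : exists r : R^o, (i < n)%N -> e i = r *: w.
    have [isz|_] := boolP (i < n)%N; last by exists 0.
    by have [r er] := (ex1 (e i)).1 (de i isz); exists r.
  have [r {}hr] := choice hr.
  have [|b hb] := hA r.
    move=> k Kk; apply: w_free; rewrite scaler_suml -[RHS](Ke k Kk).
    by apply: eq_bigr => i _; rewrite -scalerA hr.
  exists b, (fun=> 0); split=> [k _|i isz].
    by rewrite big1 // => i _; rewrite scaler0.
  rewrite raddf0 addr0 hr // hb // scaler_suml.
  by apply: eq_bigr => a _; rewrite scalerA.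
have [l0 [A [KA hA]]] := @noetherian_vectors R n K R_noeth Ks.
have rows (V : lmodType R) (e : nat -> V) :
    (forall a, (a < l0)%N -> \sum_(i < n) A a i *: e i = 0) ->
    forall k, K k -> \sum_(i < n) k i *: e i = 0.
  move=> he k /hA [t ht].
  under eq_bigr => i _ do rewrite (ht i (ltn_ord i)) scaler_suml.
  rewrite exchange_big big1 //= => a _.
  under eq_bigr do rewrite -scalerA.
  by rewrite -scaler_sumr he // scaler0.
(* The relations between the rows of [A], so that R^l0/K' is the image of K in R^n. *)
pose K' : set (nat -> R^o) :=
  [set v | forall i, (i < n)%N -> \sum_(a < l0) v a * A a i = 0].
have [|l [c [hc hgen]]] := IHj l0 K'.
  split=> [i _|x y hx hy i isz|r x hx i isz].
  - by rewrite big1 // => a _; rewrite mul0r.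
  - under eq_bigr do rewrite addrfctE mulrDl.
    by rewrite big_split /= hx // hy // addr0.
  - rewrite (eq_bigr (fun a : 'I_l0 => r * (x a * A a i))).
      by rewrite -mulr_sumr hx // mulr0.
    by move=> a _; rewrite mulrA.
(* A cocycle [c a] on the rows extends to R^n by injectivity; applying [d] to the extension computes
   the connecting map into degree j + 1. *)
have hG a : exists g : nat -> F j.+1, (a < l)%N ->
    forall b, (b < l0)%N -> \sum_(i < n) A b i *: g i = c a b.
  have [al|_] := boolP (a < l)%N; last by exists (fun=> 0).
  have [g hg] := injective_lift (res_injective j.+1) (hc a al).2.
  by exists g.
have [G {}hG] := choice hG.
exists l, (fun a i => d j.+1 (G a i)); split=> [a al|e de Ke].
  split=> [i _|]; first exact: res_dd.
  apply: (rows _ (fun i => d j.+1 (G a i))) => b bl.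
  have := congr1 (d j.+1) (hG a al b bl).
  rewrite (hc a al).1 // linear_sum => e; rewrite -[RHS]e.
  by apply: eq_bigr => i _; rewrite linearZ_LR.
have hg i : exists g, (i < n)%N -> e i = d j.+1 g.
  have [isz|_] := boolP (i < n)%N; last by exists 0.
  by have [g eg] := (ex j (e i)).1 (de i isz); exists g.
have [g {}hg] := choice hg.
have [||b [u [hu hx]]] := hgen (fun a => \sum_(i < n) A a i *: g i).
- move=> a al; rewrite linear_sum /= -[RHS](Ke _ (KA a al)).
  by apply: eq_bigr => i _; rewrite linearZ_LR hg.
- move=> v hv; under eq_bigr do rewrite scaler_sumr.
  rewrite exchange_big big1 //= => i _.
  under eq_bigr do rewrite scalerA.
  by rewrite -scaler_suml hv // scale0r.
have [u' hu'] := injective_lift (res_injective j) hu.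
exists b, (fun i => g i - \sum_(a < l) b a *: G a i - d j (u' i)); split.
  apply: (rows _ (fun i => g i - \sum_(a < l) b a *: G a i - d j (u' i))) => a al.
  under eq_bigr do rewrite !scalerBr.
  rewrite !sumrB hx // [X in _ - X](_ : _ = d j (u a)); last first.
    rewrite -hu' // linear_sum; apply: eq_bigr => i _; by rewrite linearZ_LR.
  rewrite [X in _ - X - _](_ : _ = \sum_(k < l) b k *: c k a).
    by rewrite addrAC addrK subrr.
  under eq_bigr do rewrite scaler_sumr.
  rewrite exchange_big /=; apply: eq_bigr => k _; rewrite -hG // scaler_sumr.
  by apply: eq_bigr => i _; rewrite !scalerA mulrC.
move=> i isz; rewrite !raddfB /= res_dd subr0 -hg // linear_sum /=.
under [X in _ = _ + (_ - X)]eq_bigr do rewrite linearZ_LR.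
by rewrite addrC subrK.
Qed.

Lemma ext_finite j J : ideal J -> exists l (c : nat -> F j.+1),
  (forall a, (a < l)%N -> cocycle j J (c a)) /\
  forall e, cocycle j J e -> exists b : nat -> R,
    coboundary j J (e - \sum_(a < l) b a *: c a).
Proof.
move=> Ji; pose K : set (nat -> R^o) := [set k | J (k 0%N)].
have [|l [c [hc hgen]]] := @ext_finite_vectors j 1 K.
  split; first exact: (ideal0 Ji).
    by move=> x y; exact: (idealD Ji).
  by move=> r x; exact: (idealM r Ji).
exists l, (fun a => c a 0%N); split=> [a al|e [he de]].
  split; last exact: (hc a al).1.
  move=> r Jr; have := (hc a al).2 (fun=> r) Jr.
  by rewrite big_ord_recl big_ord0 addr0.
have [//||b [u [hu hb]]] := hgen (fun=> e).
  by move=> k Kk; rewrite big_ord_recl big_ord0 addr0; apply: he.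
exists b, (u 0%N); split; last by rewrite (hb 0%N) // addrC addKr.
by move=> r Jr; have := hu (fun=> r) Jr; rewrite big_ord_recl big_ord0 addr0.
Qed.

Lemma ext_vanish_uniform q j J : prime_ideal q -> ideal J -> ext_vanish q j J ->
  exists s, ~ q s /\ forall c, cocycle j J c -> coboundary j J (s *: c).
Proof.
move=> qp Ji van; have [l [c [hc hgen]]] := ext_finite j Ji.
have [s [nqs hs]] : exists s, ~ q s /\
    forall k, (k < l)%N -> coboundary j J (s *: c k).
  (* With all coefficients zero, [nakayama] merely multiplies the elements found for the finitely
     many generators. *)
  apply: nakayama => //; first exact: coboundary_submodule.
  move=> k kl; have [s [nqs hs]] := van _ (hc k kl); exists s; split=> //.
  exists (fun=> 0); split; first by move=> _; exact: ideal0 (prime_idealW qp).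
  by rewrite big1 ?subr0 // => i _; rewrite scale0r.
exists s; split=> // e /hgen [b hb].
rewrite -[e](subrK (\sum_(a < l) b a *: c a)) scalerDr.
have [_ hD hZ] := coboundary_submodule j J.
apply: hD; first exact: hZ.
rewrite scaler_sumr; apply: submodule_sum; first exact: coboundary_submodule.
by move=> i; rewrite scalerA mulrC -scalerA; apply/hZ/hs.
Qed.

Lemma annihilator_prime p x : prime_ideal p -> ~ p x -> annihilator p x = p.
Proof.
move=> pp npx; apply/seteqP; split=> r; rewrite /annihilator /=.
  by case: pp => _ h /h [].
by apply: ideal_mulr; exact: prime_idealW pp.
Qed.

(* Multiplication by [x] is onto on [Ext^j(R/p, R)] localized at [q]. *)
Lemma ext_vanish_prime q p x j : prime_ideal q -> prime_ideal p -> q x -> ~ p x ->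
  ext_vanish q j.+1 (add_principal p x) -> ext_vanish q j p.
Proof.
move=> qp pp qx npx van; have pi := prime_idealW pp; have qi := prime_idealW qp.
have [l [c [hc hgen]]] := ext_finite j pi.
have [s [nqs hs]] : exists s, ~ q s /\
    forall k, (k < l)%N -> coboundary j p (s *: c k).
  apply: nakayama => //; first exact: coboundary_submodule.
  move=> k kl; have ck := hc k kl; rewrite -(annihilator_prime pp npx) in ck.
  have [s [nqs [c' [c'p e]]]] := ext_exact_connecting pi van ck.
  exists s; split=> //; have [b hb] := hgen c' c'p.
  exists (fun a => x * b a); split; first by move=> a; exact: ideal_mulr.
  rewrite e; under eq_bigr do rewrite -scalerA.
  by rewrite -scaler_sumr -scalerBr; apply: coboundaryZ.
move=> e /hgen [b hb]; exists s; split=> //.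
rewrite -[e](subrK (\sum_(a < l) b a *: c a)) scalerDr.
have [_ hD hZ] := coboundary_submodule j p.
apply: hD; first exact: hZ.
rewrite scaler_sumr; apply: submodule_sum; first exact: coboundary_submodule.
by move=> i; rewrite scalerA mulrC -scalerA; apply/hZ/hs.
Qed.

Lemma ext_vanish_trivial q j J : ~ (J `<=` q) -> ext_vanish q j J.
Proof.
move=> nJq c [hc _]; have [s Js nqs] := not_subset nJq.
exists s; split=> //; rewrite hc //.
by have [] := coboundary_submodule j J.
Qed.

(** This replaces a filtration of R/J with quotients R/p: choose y with (J : y) prime, and use the
    exact sequence with ends R/(J : y) and R/(J + Ry). *)
Lemma ext_vanish_of_primes q j J : prime_ideal q -> ideal J ->
  (forall p, prime_ideal p -> J `<=` p -> p `<=` q -> ext_vanish q j p) ->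
  ext_vanish q j J.
Proof.
move=> qp; move: J; apply: (noetherian_ind R_noeth) => J Ji IH hp.
have [Jq|nJq] := pselect (J `<=` q); last exact: ext_vanish_trivial.
have [|r pp] := @associated_multiple _ R_noeth J 1 Ji.
  by move=> /Jq; apply: prime_ideal1.
set y := r * 1 in pp; have Jp := @sub_annihilator _ J y Ji.
have nJy : ~ J y by move=> Jy; apply: (prime_ideal1 pp); rewrite /annihilator /= mul1r.
have vp : ext_vanish q j (annihilator J y).
  have [pq|npq] := pselect (annihilator J y `<=` q); last exact: ext_vanish_trivial.
  exact: hp.
have va : ext_vanish q j (add_principal J y).
  apply: IH; first exact: add_principal_ideal.
  - exact: sub_add_principal.
  - by move=> h; apply/nJy/h/mem_add_principal.
  - move=> p' p'p Jyp'; apply: hp => //.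
    by apply: subset_trans Jyp'; exact: sub_add_principal.
move=> c cJ; have [|s [nqs hs]] := vp (y *: c).
  split; first by apply: killed_annihilator; case: cJ.
  by rewrite linearZ_LR; case: cJ => _ ->; rewrite scaler0.
have [|t [nqt ht]] := ext_exact_middle qp Ji (cocycleZ s cJ) _ va.
- by rewrite scalerA mulrC -scalerA.
exists (t * s); split; first exact: prime_idealM.
by rewrite -scalerA.
Qed.

(** Over the localization at q, the residue field tests for vanishing: for a prime p strictly inside
    q and x in q outside p, degree j + 1 over the larger ideal p + Rx controls degree j over p. *)
Lemma ext_vanish_above q i : prime_ideal q ->
  (forall j, (i < j)%N -> ext_vanish q j q) ->
  forall J, ideal J -> forall j, (i < j)%N -> ext_vanish q j J.
Proof.
move=> qp hq; apply: (noetherian_ind R_noeth) => J Ji IH j ij.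
apply: ext_vanish_of_primes => // p pp Jp pq.
have [qpp|nqp] := pselect (q `<=` p).
  by have -> : p = q; [apply/seteqP; split|exact: hq].
have [x qx npx] := not_subset nqp.
apply: (ext_vanish_prime (x := x)) => //; apply: IH; last exact: ltnW.
- exact: add_principal_ideal (prime_idealW pp).
- exact: subset_trans Jp (@sub_add_principal _ p x).
- by move=> h; apply/npx/Jp/h/mem_add_principal/prime_idealW.
Qed.

Lemma ext_vanish_below q i p : prime_ideal q -> prime_ideal p -> p `<=` q ->
  ~ (q `<=` p) -> (forall j, (i < j)%N -> ext_vanish q j q) -> ext_vanish q i p.
Proof.
move=> qp pp pq nqp hq.
have [x qx npx] := not_subset nqp.
apply: (ext_vanish_prime (x := x)) => //; apply: (ext_vanish_above qp hq) => //.
exact: add_principal_ideal (prime_idealW pp).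
Qed.

(** For a prime p over J, a single s outside p kills Ext^j(R/p, R), by finite generation. So
    Ext^j(R/p, R) is the image of Ext^j(R/(p + Rs), R), which vanishes at m by induction. *)
Lemma ext_vanish_support m j J : prime_ideal m -> ideal J ->
  (forall q, prime_ideal q -> J `<=` q -> ext_vanish q j q) -> ext_vanish m j J.
Proof.
move=> mp; move: J; apply: (noetherian_ind R_noeth) => J Ji IH hq.
apply: ext_vanish_of_primes => // p pp Jp pm.
have pi := prime_idealW pp.
have IHp K : ideal K -> p `<=` K -> ~ (K `<=` p) -> ext_vanish m j K.
  move=> Ki pK nKp; apply: IH => //; first exact: subset_trans pK.
    by move=> KJ; apply: nKp; exact: subset_trans Jp.
  by move=> q qp Kq; apply: hq => //; apply: subset_trans Kq; exact: subset_trans pK.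
have [s [nps hs]] := ext_vanish_uniform pp pi (hq p pp Jp).
move=> c cp; apply: (ext_exact_middle (y := s)) => //.
  by rewrite annihilator_prime //; exact: hs.
apply: IHp; [exact: add_principal_ideal|exact: sub_add_principal|].
by move=> h; apply/nps/h/mem_add_principal.
Qed.

End FiniteGeneration.
End Cohomology.

Arguments cocycle {R F} d j J c.
Arguments coboundary {R F} d j J c.
Arguments ext_vanish {R F} d q j J.
Arguments res_injective {R F d w} F_res i [A B].

(** * Maximal regular sequences *)

Section RegularSequences.
Variables (R : comNzRingType).
Implicit Types (I J a p q : set R) (xs ys zs : seq R).

(** Each extension strictly enlarges the generated ideal, so Noetherian induction applies. *)
Lemma regular_seq_extend a xs : noetherian R -> regular_seq xs -> [set` xs] `<=` a ->
  exists ys, maximal_regular_seq_in a (xs ++ ys).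
Proof.
move=> R_noeth.
pose P J := forall xs, ideal_gen xs = J -> regular_seq xs -> [set` xs] `<=` a ->
  exists ys, maximal_regular_seq_in a (xs ++ ys).
suff h : forall J, ideal J -> P J by exact: (h _ (ideal_gen_ideal xs) xs).
apply: (noetherian_ind R_noeth) => {xs} J Ji IH xs xsJ xsr xsa.
have [mx|nmx] := pselect (forall y, a y -> ~ regular_seq (rcons xs y)).
  by exists [::]; rewrite cats0.
have [y ay ry] : exists2 y, a y & regular_seq (rcons xs y).
  by apply: contrapT => h; apply: nmx => y ay ry; apply: h; exists y.
have [_ nzd pr] := (regular_seq_rcons xs y).1 ry.
have [|||//||ys hys] :=
  IH (ideal_gen (rcons xs y)) (ideal_gen_ideal _) _ _ (rcons xs y).
- by rewrite -xsJ ideal_gen_rcons; exact: sub_add_principal.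
- rewrite -xsJ ideal_gen_rcons => h.
  have : ideal_gen xs (1 * y).
    by rewrite mul1r; apply/h/mem_add_principal/ideal_gen_ideal.
  move=> /nzd xs1; case: xsr => + _; rewrite ideal_properE; first exact.
  exact: ideal_gen_ideal.
- by [].
- by move=> z /=; rewrite mem_rcons in_cons => /orP[/eqP -> //|]; exact: xsa.
by exists (y :: ys); rewrite -cat_rcons.
Qed.

Lemma maximal_regular_zerodivisor a xs : ideal a -> ~ a 1 ->
  maximal_regular_seq_in a xs ->
  forall y, a y -> ~ nonzerodivisor (ideal_gen xs) y.
Proof.
move=> ai na1 [xsr xsa mx] y ay nzd; apply: (mx y ay).
apply/regular_seq_rcons; split=> //; rewrite ideal_properE; last exact: ideal_gen_ideal.
move=> h; apply: na1; move: h; apply: ideal_gen_min => // z /=.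
by rewrite mem_rcons in_cons => /orP[/eqP -> //|]; exact: xsa.
Qed.

End RegularSequences.

(** * Ext modules over an ideal generated by a regular sequence *)

Section RegularCohomology.
Variables (R : comNzRingType).
Variables (F : nat -> lmodType R) (d : forall i, {linear F i -> F i.+1}) (w : F 1%N).
Arguments d : clear implicits.
Hypothesis F_res : resolves d w.
Notation cocycle := (cocycle d).
Notation coboundary := (coboundary d).

(* For [I] generated by a regular sequence of length [t]: [Ext^j(R/I, R)]      *)
(* vanishes for [j <> t] and is [R/I], generated by [o], for [j = t]; the      *)
(* exact complex of [I]-torsion submodules splits up to degree [t].            *)
Definition regular_ext (I : set R) (t : nat) (o : F t.+1) : Prop :=
  [/\ cocycle t I o,
      (forall j c, j <> t -> cocycle j I c -> coboundary j I c),
      (forall c, cocycle t I c -> exists r, coboundary t I (c - r *: o)),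
      (forall r, coboundary t I (r *: o) -> I r)
    & forall i, (i <= t)%N -> exists h : {linear F i.+1 -> F i},
        forall u, killed I u -> d i (h (d i u)) = d i u].

Lemma regular_ext_nil : regular_ext (ideal_gen [::]) w.
Proof.
case: (F_res) => F0 Finj wfree ex1 ex.
have k0 (V : lmodType R) (x : V) : killed (ideal_gen [::]) x.
  by move=> r; rewrite ideal_gen_nil => ->; rewrite scale0r.
split.
- by split=> //; apply: (ex1 _).2; exists 1; rewrite scale1r.
- move=> [//|j] c _ [_ dc]; have [y cy] := (ex j c).1 dc.
  by exists y.
- move=> c [_ dc]; have [r ->] := (ex1 c).1 dc; exists r; rewrite subrr.
  by have [] := coboundary_submodule d 0 (ideal_gen [::]).
- move=> r [u [_]]; rewrite (F0 u) raddf0 => /wfree ->.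
  exact: ideal0 (ideal_gen_ideal _).
- move=> i; rewrite leqn0 => /eqP ->.
  exists (@GRing.null_fun (F 1%N) (F 0%N) : {linear _ -> _}) => u _.
  by rewrite (F0 u) !raddf0.
Qed.

(** In the long exact sequence of 0 -> R/I --x--> R/I -> R/(I + Rx) -> 0, multiplication by x on
    Ext^t(R/I, R) = R/I is injective with cokernel R/(I + Rx). The connecting map carries this
    cokernel to degree t + 1: the new generator is [d e], where x e = o. *)
Lemma regular_ext_step I t (o : F t.+1) x : ideal I -> nonzerodivisor I x ->
  regular_ext I o -> exists o' : F t.+2, regular_ext (add_principal I x) o'.
Proof.
move=> Ii nzd [[ko do_] Hne Ht Hinj Hsplit].
have Finj := res_injective F_res.
have annI : annihilator I x `<=` I by move=> r; exact: nzd.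
have divx i (u : F i) : killed I u -> exists v, killed I v /\ x *: v = u.
  by move=> ku; apply: (injective_divide (Finj i) Ii); exact: killedS ku.
have kx i (u : F i) : killed I u -> x *: u = 0 -> killed (add_principal I x) u.
  exact: killed_add_principal.
have kI i (u : F i) : killed (add_principal I x) u -> killed I u.
  by apply: killedS; exact: sub_add_principal.
have kX i (u : F i) : killed (add_principal I x) u -> x *: u = 0.
  by apply; exact: mem_add_principal.
have [e [ke xe]] := divx _ o ko.
have co' : cocycle t.+1 (add_principal I x) (d t.+1 e).
  split; last exact: (res_dd F_res).
  by apply: kx; [exact: killed_map|rewrite -linearZ_LR xe].
have Hne' j c : j <> t.+1 -> cocycle j (add_principal I x) c ->
    coboundary j (add_principal I x) c.
  move=> jt [kc dc].
  have [u [ku cu]] : coboundary j I c.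
    have [jt'|/eqP jt'] := eqVneq j t; last by apply: Hne => //; split=> //; exact: kI.
    subst j; have [|r [u [ku e']]] := Ht c; first by split=> //; exact: kI.
    (* Since x kills c, this class is zero; hence r lies in I and [r *: o] vanishes. *)
    have : coboundary t I ((x * r) *: o).
      exists (- (x *: u)); split.
        exact: submoduleN (killed_submodule _ _) _ (killedZ _ ku).
      by rewrite raddfN /= linearZ_LR -e' scalerBr (kX _ _ kc) sub0r opprK scalerA.
    move=> /Hinj; rewrite mulrC => /nzd Ir; exists u; split=> //.
    by rewrite -e' ko // subr0.
  case: j jt c kc dc u ku cu => [|i] jt c kc dc u ku cu.
    by exists u; split=> //; rewrite (res0 F_res u); exact: killed0.
  have [||v [kv xv]] := Hne i (x *: u).
  - by move=> it; apply: jt; rewrite it.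
  - by split; [exact: killedZ|rewrite linearZ_LR -cu (kX _ _ kc)].
  have [v' [kv' xv']] := divx _ v kv.
  exists (u - d i v'); split; last by rewrite raddfB /= (res_dd F_res) subr0.
  apply: kx; first by apply: killedB => //; exact: killed_map.
  by rewrite scalerBr -linearZ_LR xv' xv subrr.
exists (d t.+1 e); split=> //.
- move=> c [kc dc]; have [||u [ku cu]] := Hne t.+1 c.
  + by move=> /esym/n_Sn.
  + by split=> //; exact: kI.
  have [|r [v [kv xv]]] := Ht (x *: u).
    by split; [exact: killedZ|rewrite linearZ_LR -cu (kX _ _ kc)].
  have [v' [kv' xv']] := divx _ v kv.
  exists r, (u - r *: e - d t v'); split; last first.
    by rewrite !raddfB /= (res_dd F_res) subr0 linearZ_LR -cu.
  apply: kx.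
    by apply: killedB; [apply: killedB => //; exact: killedZ|exact: killed_map].
  by rewrite !scalerBr -linearZ_LR xv' -xv scalerA mulrC -scalerA xe subrr.
- move=> r [f [kf rf]].
  (* The difference of two primitives is a cocycle, hence s o up to a coboundary; multiplying by x
     compares r o with x s o. *)
  have [|s [u [ku su]]] := Ht (r *: e - f).
    split; last by rewrite raddfB /= linearZ_LR rf subrr.
    by apply: killedB; [exact: killedZ|exact: kI].
  have : coboundary t I ((r - x * s) *: o).
    exists (x *: u); split; first exact: killedZ.
    rewrite linearZ_LR -su !scalerBr (kX _ _ kf) subr0 scalerBl; congr (_ - _).
      by rewrite scalerA mulrC -scalerA xe.
    by rewrite scalerA.
  move=> /Hinj h; exists (r - x * s), s; split=> //; ring.
- move=> i; rewrite leq_eqVlt => /orP[/eqP ->|]; last first.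
    rewrite ltnS => it; have [h hh] := Hsplit i it; exists h => u ku.
    exact/hh/kI.
  have [h0 hh0] := Hsplit t (leqnn t).
  (* Subtracting [d (h0 u)] from u leaves a value depending only on [d u]: if [d u] is zero, u is a
     boundary by [Hne'] and the difference vanishes. *)
  pose G (y : F t.+2) (z : F t.+1) := exists u, [/\ killed (add_principal I x) u,
    y = d t.+1 u & z = u - d t (h0 u)].
  have [|h hG] := @injective_partial R _ _ G _ (Finj t.+1).
    split; [split|] => /=.
    + by exists 0; rewrite !raddf0 addr0; split=> //; exact: killed0.
    + move=> [y z] [y' z'] [u [ku /= -> ->]] [u' [ku' /= -> ->]]; exists (u + u').
      by rewrite !linearD /= addrACA; split=> //; exact: killedD.
    + move=> r [y z] [u [ku /= -> ->]]; exists (r *: u).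
      by rewrite !linearZ_LR /= scalerDr; split=> //; exact: killedZ.
    + move=> z [u [ku /esym du ->]].
      have [|//|v [kv ->]] := Hne' t u; first by move/n_Sn.
      by rewrite hh0 ?subrr //; exact: kI.
  exists h => u ku; rewrite (hG _ (u - d t (h0 u))); last by exists u.
  by rewrite raddfB /= (res_dd F_res) subr0.
Qed.

Lemma regular_seq_ext xs : regular_seq xs ->
  exists o : F (size xs).+1, regular_ext (ideal_gen xs) o.
Proof.
elim/last_ind: xs => [|xs y IHxs]; first by exists w; exact: regular_ext_nil.
move=> /regular_seq_rcons [xsr nzd _].
rewrite size_rcons ideal_gen_rcons.
have [o ho] := IHxs xsr; apply: regular_ext_step ho => //.
exact: ideal_gen_ideal.
Qed.

Section Above.
Variables (I J : set R) (t : nat) (o : F t.+1).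
Hypotheses (IJ : I `<=` J) (Io : regular_ext I o).

(** The splitting [h] is linear, so [h c] is killed by whatever kills c; it replaces a primitive
    killed only by I. *)
Lemma regular_ext_coboundary j c : (j <= t)%N -> killed J c ->
  coboundary j I c -> coboundary j J c.
Proof.
case: Io => _ _ _ _ hs jt kc [u [ku cu]]; have [h hh] := hs j jt.
by exists (h c); split; [exact: killed_map|rewrite cu hh].
Qed.

Lemma regular_ext_lt j c : (j < t)%N -> cocycle j J c -> coboundary j J c.
Proof.
move=> jt [kc dc]; apply: regular_ext_coboundary => //; first exact: ltnW.
case: Io => _ h _ _ _; apply: h; first by move=> e; rewrite e ltnn in jt.
by split=> //; exact: killedS kc.
Qed.

(** With the next two lemmas, r -> r o is an isomorphism from (I : J)/I onto Ext^t(R/J, R). *)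
Lemma regular_ext_eq c : cocycle t J c ->
  exists r, colon I J r /\ coboundary t J (c - r *: o).
Proof.
case: (Io) => -[ko do_] _ ht hi _ [kc dc].
have [|r hr] := ht c; first by split=> //; exact: killedS kc.
have cr : colon I J r.
  move=> x Jx; apply: hi; have [u [ku e]] := hr.
  exists (- (x *: u)); split.
    exact: submoduleN (killed_submodule _ _) _ (killedZ _ ku).
  rewrite raddfN /= linearZ_LR -e scalerBr kc // sub0r opprK scalerA.
  by rewrite mulrC.
exists r; split=> //; apply: regular_ext_coboundary => //.
by apply: killedB => // x Jx; rewrite scalerA mulrC ko //; apply: cr.
Qed.

Lemma regular_ext_cocycle r : colon I J r -> cocycle t J (r *: o).
Proof.
case: Io => -[ko do_] _ _ _ _ cr; split; last by rewrite linearZ_LR do_ scaler0.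
by move=> x Jx; rewrite scalerA mulrC ko //; apply: cr.
Qed.

Lemma regular_ext_inj r : coboundary t J (r *: o) -> I r.
Proof. by case: Io => _ _ _ hi _ h; apply: hi; exact: coboundaryS h. Qed.

End Above.

Lemma maximal_regular_colon (a : set R) xs : noetherian R -> ideal a -> ~ a 1 ->
  maximal_regular_seq_in a xs ->
  exists v, ~ ideal_gen xs v /\ colon (ideal_gen xs) a v.
Proof.
move=> R_noeth ai na1 amax.
have [v [nv hv]] := zerodivisors_colon R_noeth (ideal_gen_ideal xs) ai
  (maximal_regular_zerodivisor ai na1 amax).
by exists v; split=> // x /hv; rewrite mulrC.
Qed.

(* The common length is the least [t] with [Ext^t(R/a, R) <> 0]. *)
Lemma maximal_regular_size (a : set R) xs ys : noetherian R ->
  ideal a -> ~ a 1 -> maximal_regular_seq_in a xs -> maximal_regular_seq_in a ys ->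
  (size xs <= size ys)%N.
Proof.
move=> R_noeth ai na1 xm ym; rewrite leqNgt; apply/negP => yx.
have [xr xa _] := xm; have [yr ya _] := ym.
have [o ho] := regular_seq_ext xr; have [o' ho'] := regular_seq_ext yr.
have [v [nv cv]] := maximal_regular_colon R_noeth ai na1 ym.
apply: nv; apply: (regular_ext_inj _ ho' (J := a)); first exact: ideal_gen_min.
apply: (regular_ext_lt _ ho) => //; first exact: ideal_gen_min.
exact: (regular_ext_cocycle ho').
Qed.

(** * Non-vanishing of Ext and chains of primes *)

Section Dimension.
Variables (m : set R) (T : nat).
Hypotheses (R_noeth : noetherian R) (R_local : local_ring m).
Notation ext_vanish := (ext_vanish d).
Hypothesis T_only : forall j, j <> T -> ext_vanish m j m.

Let m_prime := local_prime R_noeth R_local.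

Lemma prime_sub_local (p : set R) : prime_ideal p -> p `<=` m.
Proof.
move=> pp; apply: (local_sub R_noeth R_local); first exact: prime_idealW.
exact: prime_ideal1.
Qed.

Lemma ext_nonvanish_above p q i : prime_ideal p -> prime_ideal q -> p `<=` q ->
  ~ (q `<=` p) -> ~ ext_vanish p i p -> exists j, (i < j)%N /\ ~ ext_vanish q j q.
Proof.
move=> pp qp pq nqp nv; apply: contrapT => h; apply: nv.
apply: (ext_vanishW pq); apply: (ext_vanish_below F_res R_noeth) => // j ij.
by apply: contrapT => nv; apply: h; exists j.
Qed.

(** Take x in m outside p. If degree i + 1 vanished at all larger primes, then so would
    Ext^{i+1}(R/(p + Rx), R) at m by [ext_vanish_support], and Nakayama would give Ext^i(R/p, R) =
    0. *)
Lemma ext_nonvanish_next p i : prime_ideal p -> ~ (m `<=` p) -> ~ ext_vanish p i p ->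
  exists q, [/\ prime_ideal q, p `<=` q, ~ (q `<=` p) & ~ ext_vanish q i.+1 q].
Proof.
move=> pp nmp nv; apply: contrapT => h; apply: nv.
have [x mx npx] := not_subset nmp.
apply: (ext_vanishW (prime_sub_local pp)).
apply: (ext_vanish_prime F_res R_noeth m_prime pp mx npx).
apply: (ext_vanish_support F_res R_noeth) => //.
  exact: add_principal_ideal (prime_idealW pp).
move=> q qp pxq; apply: contrapT => nv; apply: h; exists q; split=> //.
  by apply: subset_trans pxq; exact: sub_add_principal.
by move=> qp'; apply/npx/qp'/pxq/mem_add_principal/prime_idealW.
Qed.

Lemma ext_nonvanish_le p i : prime_ideal p -> ~ ext_vanish p i p -> (i <= T)%N.
Proof.
move=> pp nv; have [mp|nmp] := pselect (m `<=` p).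
  have pm : p = m by apply/seteqP; split=> //; exact: prime_sub_local.
  rewrite pm in nv; have [-> //|/eqP iT] := eqVneq i T.
  by case: nv; exact: T_only.
have [j [ij nvj]] := ext_nonvanish_above pp m_prime (prime_sub_local pp) nmp nv.
have [<-|/eqP jT] := eqVneq j T; first exact: ltnW.
by case: nvj; exact: T_only.
Qed.

(** Each strict inclusion raises the degree of a non-vanishing Ext by at least one, and no such
    degree exceeds T. *)
Lemma chain_bound (p : nat -> set R) k i :
  (forall l, (l <= k)%N -> prime_ideal (p l)) ->
  (forall l, (l < k)%N -> p l `<` p l.+1) -> ~ ext_vanish (p 0%N) i (p 0%N) ->
  (i + k <= T)%N.
Proof.
move=> pp plt nv.
have : exists j, (i + k <= j)%N /\ ~ ext_vanish (p k) j (p k).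
  elim: k pp plt => [|k IHk] pp plt; first by exists i; rewrite addn0.
  have [||j [ij nvj]] := IHk.
  - by move=> l lk; apply: pp; exact: leqW.
  - by move=> l lk; apply: plt; exact: leqW.
  have [pk npk] := plt k (ltnSn k).
  have [j' [jj' nvj']] :=
    ext_nonvanish_above (pp k (leqnSn k)) (pp k.+1 (leqnn _)) pk npk nvj.
  by exists j'; split=> //; rewrite addnS; exact: leq_ltn_trans jj'.
move=> [j [ikj nvj]]; apply: leq_trans ikj _.
exact: ext_nonvanish_le (pp k (leqnn k)) nvj.
Qed.

(** Away from m the degree can be raised by exactly one ([ext_nonvanish_next]), and at m it is T.
    Together with [chain_bound] this gives dim R/p = T - i. *)
Lemma chain_exists p i : prime_ideal p -> ~ ext_vanish p i p -> prime_chain p (T - i).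
Proof.
move: {2}(T - i)%N (erefl (T - i)%N) => n.
elim: n i p => [|n IHn] i p Ti pp nv; rewrite Ti.
  by exists (fun=> p); split=> [k _|k]; [split|rewrite ltn0].
have [mp|nmp] := pselect (m `<=` p).
  have pm : p = m by apply/seteqP; split=> //; exact: prime_sub_local.
  rewrite pm in nv; case: nv; apply: T_only => iT.
  by rewrite iT subnn in Ti.
have [q [qp pq nqp nvq]] := ext_nonvanish_next pp nmp nv.
have Tn : (T - i.+1 = n)%N by lia.
have := IHn i.+1 q Tn qp nvq; rewrite Tn => -[c [c1 c2]].
exists (fun k => if k is k'.+1 then c k' else p); split=> [[|k] kn|[|k] kn] //.
- by split.
- by have [h1 h2] := c1 k kn; split=> //; exact: subset_trans h2.
- have [_ qc] := c1 0%N (leq0n n); split; first exact: subset_trans qc.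
  by move=> cp; apply: nqp; exact: subset_trans cp.
- exact: c2.
Qed.

End Dimension.

(* Hence the injective dimension of [R], when finite, is its depth (Bass). *)
Lemma finite_resolution_ext m n zs : noetherian R -> local_ring m ->
  (forall i, (n < i)%N -> forall x : F i.+1, x = 0) -> maximal_regular_seq_in m zs ->
  forall j, j <> size zs -> ext_vanish d m j m.
Proof.
move=> R_noeth R_local Fn zmax.
have mp := local_prime R_noeth R_local; have mi := prime_idealW mp.
have m1 := prime_ideal1 mp.
have [zr zm _] := zmax; have [o ho] := regular_seq_ext zr.
have Im : ideal_gen zs `<=` m by exact: ideal_gen_min.
have Ii := ideal_gen_ideal zs.
have [v [nv cv]] := maximal_regular_colon R_noeth mi m1 zmax.
(* Multiplication by v embeds the residue field into R modulo the ideal of [zs]. *)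
have annv : annihilator (ideal_gen zs) v = m.
  apply/seteqP; split; last by move=> x mx; rewrite /annihilator /= mulrC; apply: cv.
  apply: (local_sub R_noeth R_local); first exact: annihilator_ideal.
  by rewrite /annihilator /= mul1r.
(* Descending induction on j: vanishing above j makes Ext^j of R modulo the ideal of [zs] map onto
   Ext^j(k, R) at m, and the former is zero for j other than [size zs]. *)
have desc k j : (size zs < j)%N -> (n < j + k)%N -> ext_vanish d m j m.
  elim: k j => [|k IHk] j zj nj.
    rewrite addn0 in nj => c _; exists 1; split=> //.
    rewrite (Fn j nj (1 *: c)).
    by have [] := coboundary_submodule d j m.
  have van : forall J, ideal J -> forall j', (j < j')%N -> ext_vanish d m j' J.
    apply: (ext_vanish_above F_res R_noeth mp) => j' jj'; apply: IHk; lia.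
  rewrite -{2}annv => c cm.
  have [|s [nms [c' [c'I e]]]] := ext_exact_connecting F_res Ii _ cm (q := m).
    by apply: van => //; exact: add_principal_ideal.
  exists s; split=> //; rewrite e.
  have [_ Hne _ _ _] := ho; have [|u [ku ->]] := Hne j c' _ c'I.
    by move=> jz; rewrite jz ltnn in zj.
  exists (v *: u); rewrite linearZ_LR; split=> //.
  exact: killed_annihilator.
move=> j jz; have [jlt|jge] := ltnP j (size zs).
  move=> c cm; exists 1; split=> //; rewrite scale1r.
  exact: (regular_ext_lt Im ho).
apply: (desc n.+1); lia.
Qed.

End RegularCohomology.

(** * Dimension of quotient rings *)

Section QuotientDimension.
Variable R : comNzRingType.

Lemma quotient_dimE (I : set R) n : prime_chain I n ->
  (forall k, prime_chain I k -> (k <= n)%N) -> quotient_dim I = Some n.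
Proof.
move=> h1 h2; rewrite /quotient_dim; case: xgetP => [o _ [n' [-> g1 g2]]|/(_ (Some n))].
  by congr Some; apply/eqP; rewrite eqn_leq h2 // g2.
by case; exists n.
Qed.

Lemma quotient_dimP (I : set R) n : quotient_dim I = Some n ->
  prime_chain I n /\ forall k, prime_chain I k -> (k <= n)%N.
Proof.
rewrite /quotient_dim; case: xgetP => // o _ [n' [-> g1 g2]] [<-].
by [].
Qed.

End QuotientDimension.

(** * Existence of injective resolutions *)

Section ResolutionExistence.
Variable R : comNzRingType.

Lemma zero_injective (E : lmodType R) : (forall x : E, x = 0) -> injective_module E.
Proof.
move=> E0 A B f g _; exists (@GRing.null_fun B E : {linear B -> E}) => x.
by rewrite [LHS]E0 [RHS]E0.
Qed.

Lemma rV0_eq0 (x : 'rV[R]_0) : x = 0. Proof. exact: thinmx0. Qed.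

Lemma gorenstein_resolves : gorenstein R ->
  exists (F : nat -> lmodType R) (d : forall i, {linear F i -> F i.+1}) (w : F 1%N) n,
    resolves d w /\ forall i, (n < i)%N -> forall x : F i.+1, x = 0.
Proof.
move=> [n [E [eps [d [Einj epsinj ex0 ex Evan]]]]].
pose F i : lmodType R := if i is j.+1 then E j else 'rV[R]_0.
pose dF i : {linear F i -> F i.+1} := match i with
  | 0 => @GRing.null_fun 'rV[R]_0 (E 0%N) : {linear _ -> _}
  | j.+1 => d j end.
have epsE r : eps r = r *: eps (1 : R^o).
  by rewrite -linearZ_LR; congr (eps _); rewrite -[RHS]/(r * 1) mulr1.
exists F, dF, (eps (1 : R^o)), n; split; last exact: Evan.
split.
- exact: rV0_eq0.
- by case=> [|i]; [exact/zero_injective/rV0_eq0|exact: Einj].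
- by move=> r; rewrite -epsE -(raddf0 eps) => /epsinj.
- move=> x; split=> [dx|[r ->]].
    have : [set x | d 0%N x = 0] x by [].
    by rewrite -ex0 => -[r _ <-]; exists r.
  have : range eps (eps r) by exists r.
  by rewrite ex0 /= epsE.
- move=> i x; split=> [dx|[y ->]].
    have : [set x | d i.+1 x = 0] x by [].
    by rewrite -ex => -[y _ <-]; exists y.
  have : range (d i) (d i y) by exists y.
  by rewrite ex.
Qed.

(** Stands for the quotient of [carrier] by [mark]; the resolution embeds each cokernel without
    forming it. *)
Record marked_module := MarkedModule
  { carrier : lmodType R; mark : set carrier; mark_submodule : submodule mark }.

Definition hull (P : marked_module) : lmodType R :=
  projT1 (cid (enough_injectives (@mark_submodule P))).

Definition hull_map (P : marked_module) : {linear carrier P -> hull P} :=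
  projT1 (cid (projT2 (cid (enough_injectives (@mark_submodule P))))).

Lemma hullP P : injective_module (hull P) /\
  forall x, hull_map P x = 0 <-> @mark P x.
Proof. exact: projT2 (cid (projT2 (cid (enough_injectives (@mark_submodule P))))). Qed.

Lemma zero_submodule : submodule [set 0 : R^o].
Proof.
by split=> [|x y -> ->|r x ->] //=; rewrite ?addr0 ?scaler0.
Qed.

(* The mark of each module is the image of the previous one. *)
Fixpoint resolution_stage (n : nat) : marked_module :=
  if n is k.+1 then MarkedModule (range_submodule (hull_map (resolution_stage k)))
  else MarkedModule zero_submodule.

Lemma resolution_exists :
  exists (F : nat -> lmodType R) (d : forall i, {linear F i -> F i.+1}) (w : F 1%N),
    resolves d w.
Proof.
pose G i := carrier (resolution_stage i).
pose g i : {linear G i -> G i.+1} := hull_map (resolution_stage i).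
have gP i x : g i x = 0 <-> mark x := (hullP (resolution_stage i)).2 x.
pose F i : lmodType R := if i is j.+1 then G i else 'rV[R]_0.
pose dF i : {linear F i -> F i.+1} := match i with
  | 0 => @GRing.null_fun 'rV[R]_0 (G 1%N) : {linear _ -> _}
  | j.+1 => g j.+1 end.
have gE (r : R) : g 0%N r = r *: g 0%N (1 : R^o).
  by rewrite -linearZ_LR; congr (g _ _); rewrite -[RHS]/(r * 1) mulr1.
exists F, dF, (g 0%N (1 : R^o)); split.
- exact: rV0_eq0.
- case=> [|i]; first exact/zero_injective/rV0_eq0.
  exact: (hullP (resolution_stage i)).1.
- by move=> r; rewrite -gE => /(gP 0%N r).1.
- move=> x; split=> [dx|[r ->]].
    by have [r _ <-] := (gP 1%N x).1 dx; exists r; rewrite -gE.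
  by apply: (gP 1%N _).2; exists r; rewrite // gE.
- move=> i x; split=> [dx|[y ->]]; first by have [y _ <-] := (gP i.+2 x).1 dx; exists y.
  by apply: (gP i.+2 _).2; exists y.
Qed.

End ResolutionExistence.

(** * Gorenstein rings: unmixed ideals are double colons *)

Section Linkage.
Variables (R : comNzRingType) (m : set R).
Hypotheses (R_noeth : noetherian R) (R_local : local_ring m).

Let m_prime : prime_ideal m := local_prime R_noeth R_local.
Let m_ideal : ideal m := prime_idealW m_prime.
Let m1 : ~ m 1 := prime_ideal1 m_prime.

Lemma depth_exists : exists zs, maximal_regular_seq_in m zs.
Proof.
have [|ys hys] := regular_seq_extend (a := m) R_noeth (regular_seq_nil R); first by [].
by exists ys.
Qed.

Section FiniteInjectiveDimension.
Variables (F : nat -> lmodType R) (d : forall i, {linear F i -> F i.+1}) (w : F 1%N).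
Arguments d : clear implicits.
Hypothesis F_res : resolves d w.
Variables (T : nat) (xs : seq R) (o : F (size xs).+1).
Hypothesis T_only : forall j, j <> T -> ext_vanish d m j m.
Hypothesis o_ext : regular_ext d (ideal_gen xs) o.

Let t := size xs.
Let I := ideal_gen xs.
Let I_ideal : ideal I := ideal_gen_ideal xs.

(** For p = (I : z) the class of z o in Ext^t(R/p, R) survives localization at p: if s z o is a
    coboundary, then s z lies in I and s in p. *)
Lemma associated_nonvanish z : prime_ideal (annihilator I z) ->
  ~ ext_vanish d (annihilator I z) t (annihilator I z).
Proof.
move=> pp van.
have [|s [nps hs]] := van (z *: o).
  by apply: (regular_ext_cocycle o_ext) => r; rewrite /annihilator /= mulrC.
apply: nps; rewrite scalerA in hs.
exact: (regular_ext_inj (@sub_annihilator _ I z I_ideal) o_ext hs).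
Qed.

Lemma associated_chain z (c : nat -> set R) k :
  prime_ideal (annihilator I z) -> annihilator I z `<=` c 0%N ->
  (forall l, (l <= k)%N -> prime_ideal (c l)) ->
  (forall l, (l < k)%N -> c l `<` c l.+1) ->
  (t + k <= T)%N.
Proof.
move=> pp pc cp clt.
(* The first prime of the chain is replaced by the associated prime below it, which keeps the length
   k. *)
apply: (chain_bound F_res R_noeth R_local T_only
  (p := fun l => if l is l'.+1 then c l'.+1 else annihilator I z)).
- by case=> [|l] //; exact: cp.
- case=> [|l] lk; last exact: clt.
  have [c01 nc01] := clt 0%N lk; split; first exact: subset_trans c01.
  by move=> h; apply: nc01; exact: subset_trans pc.
- exact: associated_nonvanish.
Qed.

Lemma associated_dim_le J k : I `<=` J -> prime_chain J k -> (t + k <= T)%N.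
Proof.
move=> IJ [c [c1 c2]]; have [c0p Jc0] := c1 0%N (leq0n k).
have [z [zp zc]] := associated_below R_noeth I_ideal c0p (subset_trans IJ Jc0).
apply: (associated_chain zp zc) => // l lk; by case: (c1 l lk).
Qed.

Lemma associated_minimal z p : prime_ideal (annihilator I z) -> prime_ideal p ->
  quotient_dim p = Some (T - t)%N -> annihilator I z `<=` p -> p `<=` annihilator I z.
Proof.
move=> zp pp /quotient_dimP [[c [c1 c2]] _] zp'; apply: contrapT => npz.
have tT : (t <= T)%N.
  by rewrite -[t]addn0; exact: (associated_chain zp (c := fun=> annihilator I z)).
suff : (t + (T - t).+1 <= T)%N by lia.
apply: (associated_chain zp
  (c := fun l => if l is l'.+1 then c l' else annihilator I z)) => //.
  by case=> [|l] // lk; case: (c1 l lk).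
case=> [|l] lk; last exact: c2.
have [_ pc] := c1 0%N (leq0n _); split; first exact: subset_trans pc.
by move=> h; apply: npz; exact: subset_trans h.
Qed.

Lemma double_colon a v : ideal a -> unmixed a -> I `<=` a -> ~ I v -> colon I a v ->
  a = colon I (colon I a).
Proof.
move=> ai [_ a_unm] Ia nIv cv.
apply/seteqP; split=> [x ax s|y0 hy0]; first by rewrite mulrC; apply.
apply: contrapT => nay0.
have a_dim : quotient_dim a = Some (T - t)%N.
  (* The prime (I : r v) contains a since v a lies in I; the chain over it bounds dim R/a from
     below. *)
  have [r pp] := associated_multiple R_noeth I_ideal nIv.
  have nv := associated_nonvanish pp.
  apply: quotient_dimE.
    have [c [c1 c2]] := chain_exists F_res R_noeth R_local T_only pp nv.
    exists c; split=> // i it; have [h1 h2] := c1 i it; split=> //.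
    apply: subset_trans h2 => x ax; rewrite /annihilator /= mulrCA.
    by apply: (idealM _ I_ideal); rewrite mulrC; apply: cv.
  by move=> k /(associated_dim_le Ia) h; lia.
have [r pp] := associated_multiple R_noeth ai nay0.
set y := r * y0 in pp; set p := annihilator a y in pp.
have ap : a `<=` p by exact: sub_annihilator.
have p_dim : quotient_dim p = Some (T - t)%N.
  by rewrite a_unm //; split=> //; exists y.
(* A prime between I and p contains an associated prime of I, which [associated_minimal] forces to
   be p. *)
have below p' : prime_ideal p' -> I `<=` p' -> p' `<=` p ->
    exists2 z, p = annihilator I z & p' = p.
  move=> p'p Ip' p'sp; have [z [zp zp']] := associated_below R_noeth I_ideal p'p Ip'.
  have pz := associated_minimal zp pp p_dim (subset_trans zp' p'sp).
  exists z; first by apply/seteqP; split=> //; exact: subset_trans p'sp.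
  by apply/seteqP; split=> //; exact: subset_trans zp'.
have [z pz _] := below p pp (subset_trans Ia ap) (@subset_refl _ p).
have zp : prime_ideal (annihilator I z) by rewrite -pz.
(* Otherwise [chain_bound], started in degree t + 1, would exclude the chain of length T - t that p
   has by its dimension. *)
have p_next : ext_vanish d p t.+1 p.
  apply: contrapT => nv; have [[c [c1 c2]] _] := quotient_dimP p_dim.
  have tT := ext_nonvanish_le F_res R_noeth R_local T_only pp nv.
  suff : (t.+1 + (T - t) <= T)%N by lia.
  apply: (chain_bound F_res R_noeth R_local T_only
    (p := fun l => if l is l'.+1 then c l'.+1 else p)) => //.
    by case=> [|l] // lk; case: (c1 l.+1 lk).
  case=> [|l] lk; last exact: c2.
  have [_ pc] := c1 0%N (leq0n _); have [c01 nc01] := c2 0%N lk.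
  split; first exact: subset_trans c01.
  by move=> h; apply: nc01; exact: subset_trans pc.
have van : ext_vanish d p t.+1 (add_principal a y).
  apply: (ext_vanish_of_primes F_res R_noeth pp); first exact: add_principal_ideal.
  move=> p' p'p ayp' p'sp; have [||_ _ -> //] := below p' p'p.
  - by apply: subset_trans Ia _; apply: subset_trans ayp'; exact: sub_add_principal.
  - exact: p'sp.
have zo : cocycle d t p (z *: o).
  apply: (regular_ext_cocycle o_ext) => x; rewrite pz /annihilator /= mulrC; exact.
(* By the vanishing in degree t + 1, s z o is y times a class over a, namely y s' o with s' in (I :
   a). But y s' lies in I, so s z does too, against s outside p. *)
have [s [nps [c' [c'a e]]]] := ext_exact_connecting F_res ai van zo.
have [s' [cs' [u [ku hu]]]] := regular_ext_eq Ia o_ext c'a.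
apply: nps; rewrite pz.
apply: (regular_ext_inj (@sub_annihilator _ I z I_ideal) o_ext (r := s * z)).
rewrite -pz -scalerA e; exists (y *: u); split; first exact: killed_annihilator.
rewrite linearZ_LR -hu scalerBr scalerA.
have [[ko _] _ _ _ _] := o_ext.
rewrite (ko (y * s')) ?subr0 //.
by rewrite /y -mulrA; apply: (idealM _ I_ideal); apply: hy0.
Qed.

End FiniteInjectiveDimension.

Lemma gorenstein_linked : gorenstein R -> forall a : set R, nonzero_proper a ->
  unmixed a -> forall (t : nat) (xs : seq R), is_grade a t -> regular_seq xs ->
  size xs = t -> ideal_gen xs `<` a -> linked_by a (ideal_gen xs).
Proof.
move=> /gorenstein_resolves [F [d [w [n [F_res Fvan]]]]].
move=> a a_np a_unm t xs [_ a_grade] xsr xst [Ia nIa].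
have [[ai aT] a0] := a_np.
have na1 : ~ a 1 by rewrite -ideal_properE.
have [zs zmax] := depth_exists.
have T_only := finite_resolution_ext F_res R_noeth R_local Fvan zmax.
have [o ho] := regular_seq_ext F_res xsr.
have xsa : [set` xs] `<=` a by apply: subset_trans Ia; exact: mem_ideal_gen.
(* A maximal extension of [xs] in a has the grade as its length, so nothing is added. *)
have xmax : maximal_regular_seq_in a xs.
  have [ys ysmax] := regular_seq_extend R_noeth xsr xsa.
  have := a_grade _ ysmax; rewrite size_cat xst -[RHS]addn0 => /addnI /size0nil ys0.
  by rewrite ys0 cats0 in ysmax.
have [v [nv cv]] := maximal_regular_colon R_noeth ai na1 xmax.
have Ii := ideal_gen_ideal xs.
have aE := double_colon F_res T_only ho ai a_unm Ia nv cv.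
split; first by exists xs.
split=> //; exists (colon (ideal_gen xs) a); split=> //.
- split; first split; first exact: colon_ideal.
    move=> cT; apply: nIa => x ax; rewrite -[x]mul1r.
    have : colon (ideal_gen xs) a 1 by rewrite cT.
    exact.
  move=> c0; apply: nv.
  have -> : v = 0 by have : [set 0] v by rewrite -c0.
  exact: ideal0.
- by move=> x xI y _; exact: ideal_mulr.
Qed.

(** * The converse: linkage bounds the injective dimension *)

Section Converse.
Variables (F : nat -> lmodType R) (d : forall i, {linear F i -> F i.+1}) (w : F 1%N).
Arguments d : clear implicits.
Hypothesis F_res : resolves d w.

Lemma ext_vanish_local j J c :
  ext_vanish d m j J -> cocycle d j J c -> coboundary d j J c.
Proof.
move=> van /van [s [nms hs]]; have [r rs] := local_unit R_noeth R_local nms.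
by rewrite -[c]scale1r -rs -scalerA; apply: coboundaryZ.
Qed.

(** The resolution is cut off at degree T with a kernel as last term; Baer's criterion for that
    kernel follows from the vanishing of Ext^{T+1}(R/J, R) for all J. *)
Lemma injective_dimension_le T :
  (forall J, ideal J -> ext_vanish d m T.+1 J) -> inj_dim_le R^o T.
Proof.
move=> van; have [F0 Finj wfree ex1 ex] := F_res.
(* With the index shifted back: the whole module below T, the kernel at T, zero beyond. *)
pose S i : set (F i.+1) :=
  [set x | ((T <= i)%N -> d i.+1 x = 0) /\ ((T < i)%N -> x = 0)].
have Ss i : submodule (S i).
  split=> [|x y [h1 h2] [h3 h4]|r x [h1 h2]].
  - by split=> // _; rewrite raddf0.
  - split=> iT; first by rewrite linearD /= h1 // h3 // addr0.
    by rewrite h2 // h4 // addr0.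
  - split=> iT; first by rewrite linearZ_LR h1 // scaler0.
    by rewrite h2 // scaler0.
pose E i : lmodType R := submodule_type (Ss i).
have Sd i (x : E i) : S i.+1 (d i.+1 (val x)).
  have [h1 _] := submodule_valP x.
  by split=> iT; [exact: (res_dd F_res)|exact: h1].
pose dE i (x : E i) : E i.+1 := to_submodule (Ss i.+1) (Sd i x).
have dE_lin i : linear (dE i).
  by move=> r x y; apply: val_inj; rewrite /= linearP.
pose dEl i : {linear E i -> E i.+1} :=
  HB.pack (dE i) (GRing.isLinear.Build R (E i) (E i.+1) _ (dE i) (dE_lin i)).
have Sw (r : R^o) : S 0%N (r *: w).
  by split=> // _; apply/ex1; exists r.
pose eps (r : R^o) : E 0%N := to_submodule (Ss 0%N) (Sw r).
have eps_lin : linear eps.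
  by move=> r x y; apply: val_inj; rewrite /= scalerDl scalerA.
pose epsl : {linear R^o -> E 0%N} :=
  HB.pack eps (GRing.isLinear.Build R R^o (E 0%N) _ eps eps_lin).
exists E, epsl, dEl; split.
- move=> i; apply: baer_injective => G G_lin GS.
  have [h hG] := injective_partial G_lin (Finj i.+1).
  have hE r : h r = r *: h (1 : R^o).
    by rewrite -linearZ_LR; congr (h _); rewrite -[RHS]/(r * 1) mulr1.
  have [[G0 GD GZ] Gf] := G_lin.
  have [iT|Ti] := ltnP i T.
    exists (h (1 : R^o)); last by move=> r c /hG <-; rewrite -hE.
    by split=> Ti; move: iT; rewrite ltnNge ?Ti // ltnW.
  move: Ti; rewrite leq_eqVlt => /orP[/eqP Ti|Ti]; last first.
    exists 0; first by case: (Ss i).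
    by move=> r c /GS [_ ->] //; rewrite scaler0.
  subst i; pose J : set R := [set r | exists c, G r c].
  have Ji : ideal J.
    split; first by exists 0.
      by move=> x y [c hc] [c' hc']; exists (c + c'); exact: (GD (x, c) (y, c')).
    by move=> r x [c hc]; exists (r *: c); exact: (GZ r (x, c)).
  (* The map takes values in the kernel, so J kills [d (h 1)]; a primitive u killed by J corrects
     [h 1] into the kernel. *)
  have dcoc : cocycle d T.+1 J (d T.+1 (h (1 : R^o))).
    split; last exact: (res_dd F_res).
    move=> r [c hc]; rewrite -linearZ_LR -hE (hG _ _ hc).
    by case: (GS _ _ hc) => + _; apply.
  have [u [ku eu]] := ext_vanish_local (van J Ji) dcoc.
  exists (h (1 : R^o) - u).
    by split=> [_|]; [rewrite raddfB /= eu subrr|rewrite ltnn].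
  move=> r c hc; rewrite scalerBr -hE (hG _ _ hc) ku ?subr0 //.
  by exists c.
- move=> r s /(congr1 val) /= /eqP; rewrite -subr_eq0 -scalerBl => /eqP /wfree /eqP.
  by rewrite subr_eq0 => /eqP.
- apply/seteqP; split=> [_ [r _ <-]|x /(congr1 val) /= dx].
    apply: val_inj; rewrite /=; apply/ex1; by exists r.
  have [r xr] := (ex1 (val x)).1 dx; exists r => //.
  exact: val_inj.
- move=> i; apply/seteqP; split=> [_ [y _ <-]|x /(congr1 val) /= dx].
    by apply: val_inj; exact: (res_dd F_res).
  have [iT|Ti] := ltnP i T.
    have [y xy] := (ex i (val x)).1 dx.
    have Sy : S i y.
      by split=> Ti; move: iT; rewrite ltnNge ?Ti // ltnW.
    by exists (to_submodule (Ss i) Sy) => //; apply: val_inj.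
  exists 0 => //; apply: val_inj; rewrite /= raddf0.
  by have [_ ->] := submodule_valP x.
- move=> i iT x; apply: val_inj; rewrite /=.
  by have [_ ->] := submodule_valP x.
Qed.

Hypothesis all_linked : forall a : set R, nonzero_proper a ->
  unmixed a -> forall (t : nat) (xs : seq R), is_grade a t -> regular_seq xs ->
  size xs = t -> ideal_gen xs `<` a -> linked_by a (ideal_gen xs).

Variable zs : seq R.
Hypothesis z_max : maximal_regular_seq_in m zs.
Let I := ideal_gen zs.
Let T := size zs.
Let I_ideal : ideal I := ideal_gen_ideal zs.

Definition m_primary (J : set R) : Prop :=
  [/\ ideal J, J `<=` m & forall x, m x -> exists k, J (x ^+ k)].

Lemma m_primary_prime J p : m_primary J -> prime_ideal p -> J `<=` p -> p = m.
Proof.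
move=> [Ji Jm Jk] pp Jp; apply/seteqP; split; first exact: prime_sub_local.
move=> x /Jk [k /Jp]; elim: k => [/(prime_ideal1 pp) //|k IHk].
by rewrite exprS => pxk; case: pp => _ h; case: (h _ _ pxk) => // /IHk.
Qed.

Lemma m_primary_self : m_primary m.
Proof. by split=> // x mx; exists 1%N; rewrite expr1. Qed.

Lemma m_primary_dim J : m_primary J -> quotient_dim J = Some 0%N.
Proof.
move=> Jp; have [Ji Jm _] := Jp; apply: quotient_dimE.
  by exists (fun=> m); split=> // k.
move=> [|k] // [c [c1 c2]]; exfalso.
have [c0p Jc0] := c1 0%N (leq0n _); have [c1p Jc1] := c1 1%N (ltn0Sn k).
have [_] := c2 0%N (ltn0Sn k).
by rewrite (m_primary_prime Jp c0p Jc0) (m_primary_prime Jp c1p Jc1); apply.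
Qed.

Lemma m_primary_unmixed J : m_primary J -> unmixed J.
Proof.
move=> Jp; have [Ji Jm _] := Jp; split.
  by split; rewrite ?ideal_properE // => /Jm.
move=> p [pp [x px]]; rewrite (m_primary_dim Jp).
have -> : p = m by apply: (m_primary_prime Jp pp); rewrite px; exact: sub_annihilator.
exact: m_primary_dim m_primary_self.
Qed.

(** As [zs] is maximal in m, it is maximal in J, so J has grade T; being m-primary, J is also
    unmixed, and the linkage hypothesis applies. *)
Lemma m_primary_linked J : m_primary J -> I `<` J -> J = colon I (colon I J).
Proof.
move=> Jp [IJ nJI]; have [Ji Jm _] := Jp; have nJ1 : ~ J 1 by move=> /Jm.
have [zr zm zx] := z_max.
have zJ : maximal_regular_seq_in J zs.
  split=> //; first by apply: subset_trans IJ; exact: mem_ideal_gen.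
  by move=> y /Jm; exact: zx.
have [_ [_ _ [b [_ _ -> //]]]] :
    linked_by J (ideal_gen zs).
apply: (@all_linked J _ _ (size zs)) => //.
- split; first by split; rewrite ?ideal_properE.
  move=> J0; apply: nJI; rewrite J0 => _ ->; exact: ideal0.
- exact: m_primary_unmixed.
- split; first by exists zs.
  move=> ys yJ; apply/eqP; rewrite eqn_leq.
  by rewrite !(maximal_regular_size F_res R_noeth Ji nJ1).
Qed.

Lemma I_m_primary : m_primary I.
Proof.
apply: contrapT => nIp.
have Im : I `<=` m by apply: ideal_gen_min => //; case: z_max.
pose P b := exists J, [/\ m_primary J, I `<=` J & b = colon I J].
have [|b [_ [J [Jp IJ bJ]] bmax]] := @noetherian_max _ R_noeth P.
  exists (colon I m); split; first exact: colon_ideal.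
  by exists m; split=> //; exact: m_primary_self.
have [Ji Jm Jk] := Jp.
(* This is mJ + I, as the intersection of the ideals that contain I and the products. *)
pose K : set R := [set x | forall L, ideal L -> I `<=` L ->
  (forall u v, m u -> J v -> L (u * v)) -> L x].
have Ki : ideal K.
  split=> [L Li _ _|x y hx hy L Li IL hL|r x hx L Li IL hL].
  - exact: ideal0.
  - by apply: idealD; [|exact: hx|exact: hy].
  - by apply: idealM => //; exact: hx.
have IK : I `<=` K by move=> x Ix L _ + _; apply.
have KJ : K `<=` J by move=> x; apply => // u v _; exact: idealM.
have Kp : m_primary K.
  split=> //; first exact: subset_trans Jm.
  move=> x mx; have [k Jxk] := Jk x mx; exists k.+1 => L _ _; rewrite exprS; exact.
have nI L : m_primary L -> I `<=` L -> ~ (L `<=` I).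
  by move=> Lp IL LI; apply: nIp; have -> : I = L by apply/seteqP.
(* By maximality of I : J the colons I : K and I : J agree; a second colon gives K = J. *)
have KE : K = J.
  rewrite (m_primary_linked Jp (conj IJ (nI J Jp IJ))).
  rewrite {1}(m_primary_linked Kp (conj IK (nI K Kp IK))).
  congr (colon I _); apply/seteqP; split; last by move=> x hx y /KJ; exact: hx.
  rewrite -bJ; apply: bmax; first exact: colon_ideal.
    by exists K.
  by rewrite bJ => x hx y /KJ; exact: hx.
have [ys Jys] := R_noeth Ji.
(* Since J = mJ + I is finitely generated, Nakayama puts J into I up to a unit, so I = J would be
   m-primary. *)
have [s [nms hs]] : exists s, ~ m s /\
    forall k, (k < size ys)%N -> I (s *: (ys`_k : R^o)).
  apply: (nakayama (V := R^o)) => // k ksz; exists 1; split=> //.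
  pose L : set R := [set x | exists a : nat -> R,
    (forall j, m (a j)) /\ I (x - \sum_(j < size ys) a j * ys`_j)].
  have Li : ideal L.
    split.
    - exists (fun=> 0); split; first by move=> _; exact: ideal0.
      by rewrite big1 ?subrr; [exact: ideal0|move=> j _; rewrite mul0r].
    - move=> x y [a [ma ha]] [a' [ma' ha']]; exists (fun j => a j + a' j); split.
        by move=> j; exact: idealD.
      under eq_bigr do rewrite mulrDl.
      rewrite big_split /= opprD addrACA; exact: idealD.
    - move=> r x [a [ma ha]]; exists (fun j => r * a j); split.
        by move=> j; exact: idealM.
      under eq_bigr do rewrite -mulrA.
      by rewrite -mulr_sumr -mulrBr; exact: idealM.
  have : K ys`_k by rewrite KE Jys; apply: mem_ideal_gen; rewrite /= mem_nth.
  move=> /(_ L Li) [||a [ma ha]].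
  - move=> x Ix; exists (fun=> 0); split; first by move=> _; exact: ideal0.
    by rewrite big1 ?subr0 // => j _; rewrite mul0r.
  - move=> u v mu; rewrite Jys => -[c ->].
    exists (fun j => if insub j is Some j' then u * c j' else 0); split.
      by move=> j; case: insubP => [j' _ _|_]; [exact: ideal_mulr|exact: ideal0].
    rewrite mulr_sumr -sumrB big1; first exact: ideal0.
    move=> j _; rewrite insubT //= => jsz; apply/eqP; rewrite mulrA subr_eq0.
    by apply/eqP; congr (u * c _ * _); apply: val_inj.
  by exists a; split=> //; rewrite scale1r.
apply: (nI J Jp IJ); rewrite Jys; apply: ideal_gen_min => // y /= yys.
have [r rs] := local_unit R_noeth R_local nms.
have := hs (index y ys); rewrite index_mem nth_index // => /(_ yys).
move=> /(idealM r I_ideal); congr I.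
by rewrite -[s *: _]/(s * y) mulrA rs mul1r.
Qed.

(** Linkage covers the ideals strictly above I; for J = I the colon contains 1. *)
Lemma double_colon_above J y : ideal J -> I `<=` J -> J `<=` m ->
  (forall s, colon I J s -> I (y * s)) -> J y.
Proof.
move=> Ji IJ Jm hy; have [_ _ Ik] := I_m_primary.
have [JI|nJI] := pselect (J `<=` I).
  apply: IJ; rewrite -[y]mulr1; apply: hy => x /JI; by rewrite mul1r.
rewrite (m_primary_linked (J := J)) //.
by split=> // x /Ik [k /IJ]; exists k.
Qed.

Variable o : F T.+1.
Hypothesis o_ext : regular_ext d I o.

(* [(I : m)/I] is simple because every ideal above [I] is a double colon. *)
Lemma socle_onto K y c : ideal K -> I `<=` K -> annihilator K y = m ->
  cocycle d T m c ->
  exists c', cocycle d T K c' /\ coboundary d T m (c - y *: c').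
Proof.
move=> Ki IK Ky cm; have [_ Im _] := I_m_primary.
have nKy : ~ K y by move=> h; apply: m1; rewrite -Ky /annihilator /= mul1r.
have Km : K `<=` m.
  apply: (local_sub R_noeth R_local) => // K1; apply: nKy.
  by rewrite -[y]mulr1; exact: idealM.
have [s cs nys] : exists2 s, colon I K s & ~ I (y * s).
  apply: contrapT => h; apply: nKy; apply: double_colon_above => // s cs.
  by apply: contrapT => nys; apply: h; exists s.
have [r [cr hr]] := regular_ext_eq Im o_ext cm.
have cu : colon I m (y * s).
  move=> x; rewrite -{1}Ky /annihilator /= => Kxy.
  have -> : y * s * x = s * (x * y) by ring.
  exact: cs.
(* Here y s generates (I : m) modulo I: a unit in I : (I + R y s) would put y s into I, so this
   colon lies in m, hence r multiplies it into I and the double colon contains r. *)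
have Jr : add_principal I (y * s) r.
  have Ji := add_principal_ideal (y * s) I_ideal.
  have [J1|nJ1] := pselect (add_principal I (y * s) 1).
    by rewrite -[r]mulr1; exact: idealM.
  apply: double_colon_above => //; first exact: sub_add_principal.
    exact: (local_sub R_noeth R_local).
  move=> s' cs'; apply: cr; apply: contrapT => /(local_unit R_noeth R_local) [q qs'].
  apply: nys; rewrite -[y * s]mul1r -qs' -mulrA; apply: idealM => //.
  by apply: cs'; exact: mem_add_principal.
have [i [e [Ii re]]] := Jr.
have [[ko _] _ _ _ _] := o_ext.
exists ((e * s) *: o); split.
  apply: (regular_ext_cocycle o_ext) => x Kx; rewrite -mulrA.
  by apply: idealM => //; exact: cs.
have -> // : y *: ((e * s) *: o) = r *: o.
by rewrite re scalerDl (ko i Ii) add0r scalerA; congr (_ *: _); ring.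
Qed.

(** Take L maximal between I and K with vanishing Ext^{j+1}(R/L, R). If L is not K, then K/L
    contains a copy of k because I is m-primary, and adding it to L keeps the vanishing by
    [ext_exact_quotient]. *)
Lemma ext_above_step j : (T <= j)%N ->
  (forall K y c, ideal K -> I `<=` K -> annihilator K y = m -> cocycle d j m c ->
     exists c', cocycle d j K c' /\ coboundary d j m (c - y *: c')) ->
  forall K c, ideal K -> I `<=` K -> cocycle d j.+1 K c -> coboundary d j.+1 K c.
Proof.
move=> Tj onto K c0 Ki IK cK; have [_ Hne _ _ _] := o_ext.
pose P L := [/\ I `<=` L, L `<=` K
  & forall c, cocycle d j.+1 L c -> coboundary d j.+1 L c].
have [|L [Li [IL LK hL] Lmax]] := @noetherian_max _ R_noeth P.
  exists I; split=> //; split=> // c; apply: Hne => jT.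
  by rewrite -jT ltnn in Tj.
have [KL|nKL] := pselect (K `<=` L).
  have KE : K = L by apply/seteqP.
  by rewrite KE in cK *; exact: hL.
exfalso; have [y Ky nLy] := not_subset nKL.
have [r pp] := associated_multiple R_noeth Li nLy.
have Lann : annihilator L (r * y) = m.
  apply: (m_primary_prime I_m_primary pp).
  by apply: subset_trans IL _; exact: sub_annihilator.
apply: m1; rewrite -Lann /annihilator /= mul1r.
apply: (Lmax (add_principal L (r * y))); first exact: add_principal_ideal.
- split.
  + by apply: subset_trans IL _; exact: sub_add_principal.
  + by apply: add_principal_min => //; exact: idealM.
  + move=> c cLy; apply: (ext_exact_quotient F_res Li) => //; last first.
      apply: hL; case: cLy => kc dc; split=> //.
      by apply: killedS kc; exact: sub_add_principal.
    by rewrite Lann => e em; exact: onto.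
- exact: sub_add_principal.
- exact: mem_add_principal.
Qed.

(** In degree T the required surjectivity is [socle_onto]; above T it is trivial, since Ext of k
    already vanishes there by the preceding step. *)
Lemma ext_vanish_above_depth j : (T < j)%N -> ext_vanish d m j m.
Proof.
have [_ Im _] := I_m_primary.
have main k : forall K c, ideal K -> I `<=` K ->
    cocycle d (T + k).+1 K c -> coboundary d (T + k).+1 K c.
  elim: k => [|k IHk]; apply: ext_above_step.
  - by rewrite addn0.
  - by rewrite addn0; exact: socle_onto.
  - exact: leq_addr.
  - rewrite addnS => K y c Ki IK Ky cm; exists 0; split.
      by have [] := cocycle_submodule d (T + k).+1 K.
    by rewrite scaler0 subr0; exact: IHk.
move=> Tj; have -> : j = (T + (j - T.+1)).+1 by lia.
by move=> c cm; exists 1; split=> //; rewrite scale1r; apply: main.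
Qed.

End Converse.

Lemma linked_gorenstein : (forall a : set R, nonzero_proper a ->
  unmixed a -> forall (t : nat) (xs : seq R), is_grade a t -> regular_seq xs ->
  size xs = t -> ideal_gen xs `<` a -> linked_by a (ideal_gen xs)) -> gorenstein R.
Proof.
move=> all_linked; have [F [d [w F_res]]] := resolution_exists R.
have [zs zmax] := depth_exists; have [zr _ _] := zmax.
have [o ho] := regular_seq_ext F_res zr.
exists (size zs); apply: (injective_dimension_le F_res) => J Ji.
apply: (ext_vanish_above F_res R_noeth m_prime _ Ji (ltnSn _)) => j zj.
exact: (ext_vanish_above_depth F_res all_linked zmax ho zj).
Qed.

End Linkage.

Theorem theorem3p6 (R : comNzRingType) (m : set R)
    (R_noetherian : noetherian R) (R_local : local_ring m) :
  gorenstein R <->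
  (forall a : set R, nonzero_proper a -> unmixed a ->
   forall (t : nat) (xs : seq R), is_grade a t -> regular_seq xs ->
   size xs = t -> ideal_gen xs `<` a ->
   linked_by a (ideal_gen xs)).
Proof.
split; first exact: (gorenstein_linked R_noetherian R_local).
exact: (linked_gorenstein R_noetherian R_local).
Qed.
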